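(* Let $k\in\mathbb N$, $\mu>0$. The convolution $\star_k$ defines a continuous bilinear operator $\mathcal G_k\times\mathcal G_k\to\mathcal G_k$. In particular, with $$q_k:=\frac{2^{\frac{4k-1}{k}}\,\pi}{2\cos\left(\frac{\pi(k-1)}{2k}\right)},$$ one has $q_k>0$ and, for any $H,J\in\mathcal G_k$, $$\|H\star_kJ\|_{\mu,k}\le\frac{q_k}{\mu}\,\|H\|_{\mu,k}\,\|J\|_{\mu,k}.$$
   Context: For $\nu>0$, $\alpha>0$ (small) and a direction $\theta$ let $\Omega=\Omega(\nu,\theta,\alpha)=B(\nu)\cup S(\theta,\alpha)\subset\mathbb C$, where $B(\nu)$ is the open disc of radius $\nu$ centered at $0$ and $S(\theta,\alpha)=\{w\in\mathbb C:|\operatorname{Arg}(w)-\theta|<\alpha/2\}$ (arguments modulo $2\pi$). $\mathcal G_k=\mathcal G_k(\nu,\theta,\alpha,\mu)$ is the Banach space of analytic functions $H:\Omega\to\mathbb C$ with finite norm $$\|H\|_{\mu,k}=\sup_{w\in\Omega}|H(w)|\,(1+\mu^{2k}|w|^{2k})\,e^{-\mu^k|w|^k}.$$ The convolution of order $k$ is $$(H\star_kJ)(w)=w\int_0^1(s(1-s))^{\frac{1-k}{k}}\,H(w(1-s)^{1/k})\,J(ws^{1/k})\,ds.$$ *)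

(* Defs.v *)
From Stdlib Require Import Reals.
From Coquelicot Require Import Coquelicot.
Open Scope R_scope.

Definition disc (nu : R) (w : C) : Prop := Cmod w < nu.

(* [phi] ranges over all determinations of the argument of [w], so the
   condition is understood modulo 2 PI; [w = 0] has no argument and is
   excluded by [0 < r]. *)
Definition sector (theta alpha : R) (w : C) : Prop :=
  exists r phi : R, 0 < r /\ Rabs (phi - theta) < alpha / 2 /\
    w = (r * cos phi, r * sin phi).

Definition Omega (nu theta alpha : R) (w : C) : Prop :=
  disc nu w \/ sector theta alpha w.

(* Intended for open [D]: then [r] can be shrunk so that the disc lies in [D],
   and the values of [H] outside [D] are irrelevant. *)
Definition analytic_on (D : C -> Prop) (H : C -> C) : Prop :=
  forall w0 : C, D w0 ->
  exists (r : R) (a : nat -> C), 0 < r /\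
    forall w : C, Cmod (w - w0)%C < r ->
      @is_pseries C_AbsRing C_NormedModule a (w - w0)%C (H w).

Definition Gweight (mu : R) (k : nat) (w : C) : R :=
  (1 + mu ^ (2 * k) * Cmod w ^ (2 * k)) * exp (- (mu ^ k * Cmod w ^ k)).

Definition Gnorm (nu theta alpha mu : R) (k : nat) (H : C -> C) : Rbar :=
  Lub_Rbar (fun x : R => exists w : C,
    Omega nu theta alpha w /\ x = Cmod (H w) * Gweight mu k w).

(* A function on Omega is represented by a total function C -> C, whose values
   outside Omega play no role. *)
Definition Gspace (nu theta alpha mu : R) (k : nat) (H : C -> C) : Prop :=
  analytic_on (Omega nu theta alpha) H /\
  is_finite (Gnorm nu theta alpha mu k H).

Definition conv_integrand (k : nat) (H J : C -> C) (w : C) (s : R) : C :=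
  (RtoC (Rpower (s * (1 - s)) ((1 - INR k) / INR k))
   * H (w * RtoC (Rpower (1 - s) (/ INR k)))
   * J (w * RtoC (Rpower s (/ INR k))))%C.

(* For k > 1 the integrand is singular at both endpoints, hence the improper
   integral over the open interval (0, 1). *)
Definition conv (k : nat) (H J : C -> C) (w : C) : C :=
  (w * @RInt_gen C_R_CompleteNormedModule
         (conv_integrand k H J w) (at_right 0) (at_left 1))%C.

Definition q (k : nat) : R :=
  Rpower 2 ((4 * INR k - 1) / INR k) * PI
  / (2 * cos (PI * (INR k - 1) / (2 * INR k))).

(* Main.v *)
Require Import Defs.
From Stdlib Require Import Reals.
From Coquelicot Require Import Coquelicot.
From Stdlib Require Import Lra Lia Classical ClassicalEpsilon.
From Stdlib Require Import ssreflect.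
Open Scope R_scope.

(** Write [y = mu |w|], [x = y ^ k] and [p = 1 / k]. Since [x (1 - s) + x s = x], the
    exponentials in the norms of the two factors multiply to [exp x], and the bound reduces to
    estimating [y (1 + x^2)] times the integral over (0,1) of
    [(s (1 - s)) ^ (p - 1) / ((1 + x^2 (1 - s)^2) (1 + x^2 s^2))].
    With the factor [y (1 + x^2)] included, this integrand is at most a symmetric sum of terms
    [y s ^ (p - 1) / (1 + x^2 s^2)] and [s ^ (p - 1)]; the substitution [u = y s ^ p] turns the first kind into
    [k / (1 + u ^ (2 k))], so that crude bounds suffice to get below [q k].

    Analyticity is proved without Cauchy's theorem. Omega is star-shaped about 0, so along
    the compact segment from 0 to [w0] the power series of [H] can be recentered in such a way
    that [w => H (t w)] has at [w0] an expansion whose coefficients depend continuously on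
    [t] and obey a Cauchy bound uniform in [t]. The product of two such families is again
    one, and it can be integrated term by term. *)

(** * Complex series, componentwise *)

(** The obstacle to analyticity is uniformity. [analytic_on] gives at each point some disc and some
    coefficients, unrelated from point to point, whereas integrating in [s] term by term needs one
    radius, one bound and continuous coefficients for all [s] in (0,1). Absolute convergence of a
    single expansion stands in for the Cauchy estimates, compactness of [0,1] makes radius and bound
    uniform, and uniqueness of coefficients shows that choices made at neighbouring parameters
    agree, whence continuity. Convergence of the singular integrals rests on majorants that have a
    primitive with limits at both endpoints: domination then compares increments of primitives. As
    for the constant, the symmetric majorant has integral [4 k (A + 1)], where [A], the integral of
    [1 / (1 + u ^ (2 k))] from 0 to [y], is at most [2 k / (2 k - 1)], uniformly in [y]. The cosine
    in [q k] equals [sin (PI / (2 k))], so that [sin z <= z] makes [q k] at least [k] times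
    [2 ^ (4 - 1 / k)]. This is enough for [k >= 2]; for [k = 1] the comparison is 12 against
    [4 PI]. *)

Definition is_Cseries (u : nat -> C) (l : C) : Prop :=
  is_series (fun n => fst (u n)) (fst l) /\ is_series (fun n => snd (u n)) (snd l).

Lemma fst_sum_n (u : nat -> C) (n : nat) :
  fst (@sum_n C_AbelianMonoid u n) = sum_n (fun i => fst (u i)) n.
Proof.
  induction n as [|n IH].
  - now rewrite !sum_O.
  - rewrite !sum_Sn -IH. reflexivity.
Qed.

Lemma snd_sum_n (u : nat -> C) (n : nat) :
  snd (@sum_n C_AbelianMonoid u n) = sum_n (fun i => snd (u i)) n.
Proof.
  induction n as [|n IH].
  - now rewrite !sum_O.
  - rewrite !sum_Sn -IH. reflexivity.
Qed.

(** Balls of [C] are products of balls, so convergence can be tested on components. This opens the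
    way to the theorems on real series: Cauchy products, radius of convergence, uniform
    convergence. *)
Lemma is_Cseries_is_series (u : nat -> C) (l : C) :
  @is_series C_AbsRing C_NormedModule u l <-> is_Cseries u l.
Proof.
  unfold is_Cseries, is_series. split.
  - intros H. split.
    + apply filterlim_ext with (fun n => fst (@sum_n C_AbelianMonoid u n)).
      { intros n. apply fst_sum_n. }
      intros P [e He]. specialize (H (fun z => ball (fst l) e (fst z))).
      unfold filtermap in *. generalize (H (ex_intro _ e (fun z hz => proj1 hz))).
      apply filter_imp. intros n Hn. now apply He.
    + apply filterlim_ext with (fun n => snd (@sum_n C_AbelianMonoid u n)).
      { intros n. apply snd_sum_n. }
      intros P [e He]. specialize (H (fun z => ball (snd l) e (snd z))).
      unfold filtermap in *. generalize (H (ex_intro _ e (fun z hz => proj2 hz))).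
      apply filter_imp. intros n Hn. now apply He.
  - intros [H1 H2] P [e He].
    specialize (H1 (ball (fst l) e) (locally_ball _ e)).
    specialize (H2 (ball (snd l) e) (locally_ball _ e)).
    unfold filtermap in *.
    refine (filter_imp _ _ _ (filter_and _ _ H1 H2)).
    intros n [h1 h2]. apply He. split.
    + rewrite -fst_sum_n in h1. exact h1.
    + rewrite -snd_sum_n in h2. exact h2.
Qed.

Lemma pow_n_Cpow (z : C) (n : nat) : @pow_n C_AbsRing z n = (z ^ n)%C.
Proof. induction n as [|n IH]; simpl; [reflexivity|]. now rewrite IH. Qed.

Lemma is_Cseries_ext (u v : nat -> C) (l : C) :
  (forall n, u n = v n) -> is_Cseries u l -> is_Cseries v l.
Proof.
  intros E [H1 H2]. split; (eapply is_series_ext; [|eassumption]); intros n; simpl; now rewrite E.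
Qed.

Lemma pseries_is_Cseries (a : nat -> C) (z l : C) :
  @is_pseries C_AbsRing C_NormedModule a z l <-> is_Cseries (fun n => a n * z ^ n)%C l.
Proof.
  unfold is_pseries. rewrite is_Cseries_is_series.
  split; apply is_Cseries_ext; intros n; rewrite pow_n_Cpow;
    change (@scal C_AbsRing C_NormedModule) with Cmult; ring.
Qed.

Lemma is_Cseries_plus (u v : nat -> C) (l m : C) :
  is_Cseries u l -> is_Cseries v m -> is_Cseries (fun n => u n + v n)%C (l + m)%C.
Proof.
  intros [H1 H2] [H3 H4]. split; simpl; apply: is_series_plus; assumption.
Qed.

Lemma is_Cseries_scal (c : C) (u : nat -> C) (l : C) :
  is_Cseries u l -> is_Cseries (fun n => c * u n)%C (c * l)%C.
Proof.
  intros [H1 H2]. split; simpl.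
  - apply: is_series_minus; now apply: is_series_scal.
  - apply: is_series_plus; now apply: is_series_scal.
Qed.

Lemma im_le_Cmod (z : C) : Rabs (snd z) <= Cmod z.
Proof. eapply Rle_trans; [apply Rmax_r | apply Rmax_Cmod]. Qed.

Lemma is_Cseries_abs (u : nat -> C) (v : nat -> R) :
  (forall n, Cmod (u n) <= v n) -> ex_series v -> exists l, is_Cseries u l.
Proof.
  intros Hv [L HL].
  assert (H1 : ex_series (fun n => fst (u n))).
  { apply: ex_series_le; [|exists L; exact HL]. intros n.
    eapply Rle_trans; [apply re_le_Cmod | apply Hv]. }
  assert (H2 : ex_series (fun n => snd (u n))).
  { apply: ex_series_le; [|exists L; exact HL]. intros n.
    eapply Rle_trans; [apply im_le_Cmod | apply Hv]. }
  destruct H1 as [l1 H1], H2 as [l2 H2]. exists (l1, l2). now split.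
Qed.

Lemma Cmod_sum_n (u : nat -> C) (n : nat) :
  Cmod (@sum_n C_AbelianMonoid u n) <= sum_n (fun i => Cmod (u i)) n.
Proof.
  induction n as [|n IH].
  - rewrite !sum_O. apply Rle_refl.
  - rewrite !sum_Sn. eapply Rle_trans; [apply Cmod_triangle|].
    apply Rplus_le_compat; [exact IH | apply Rle_refl].
Qed.

Lemma is_Cseries_norm_le (u : nat -> C) (v : nat -> R) (l : C) (L : R) :
  is_Cseries u l -> (forall n, Cmod (u n) <= v n) -> is_series v L -> Cmod l <= L.
Proof.
  intros Hu Hv HL. apply is_Cseries_is_series in Hu.
  assert (E : is_lim_seq (fun n => Cmod (@sum_n C_AbelianMonoid u n)) (Cmod l)).
  { apply (filterlim_comp _ _ _ _ (@norm C_AbsRing C_NormedModule) _ _ _ Hu).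
    apply (@filterlim_norm C_AbsRing C_NormedModule). }
  refine (is_lim_seq_le _ _ (Cmod l) L _ E _); [|exact HL].
  intros n. eapply Rle_trans; [apply Cmod_sum_n|]. apply sum_n_m_le. exact Hv.
Qed.

Lemma is_Cseries_mult (u v : nat -> C) (l m : C) :
  is_Cseries u l -> is_Cseries v m ->
  ex_series (fun n => Cmod (u n)) -> ex_series (fun n => Cmod (v n)) ->
  is_Cseries (fun n => @sum_n C_AbelianMonoid (fun i => u i * v (n - i)%nat)%C n) (l * m)%C.
Proof.
  intros [U1 U2] [V1 V2] AU AV.
  assert (AU1 : ex_series (fun n => Rabs (fst (u n)))).
  { apply: ex_series_le; [|exact AU]. intros n.
    rewrite /norm /= /abs /= Rabs_Rabsolu. apply re_le_Cmod. }
  assert (AU2 : ex_series (fun n => Rabs (snd (u n)))).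
  { apply: ex_series_le; [|exact AU]. intros n.
    rewrite /norm /= /abs /= Rabs_Rabsolu. apply im_le_Cmod. }
  assert (AV1 : ex_series (fun n => Rabs (fst (v n)))).
  { apply: ex_series_le; [|exact AV]. intros n.
    rewrite /norm /= /abs /= Rabs_Rabsolu. apply re_le_Cmod. }
  assert (AV2 : ex_series (fun n => Rabs (snd (v n)))).
  { apply: ex_series_le; [|exact AV]. intros n.
    rewrite /norm /= /abs /= Rabs_Rabsolu. apply im_le_Cmod. }
  split.
  - change (fst (l * m)%C) with (minus (fst l * fst m) (snd l * snd m)).
    eapply is_series_ext; cycle 1.
    + apply: is_series_minus; apply is_series_mult; eassumption.
    + intros n. rewrite fst_sum_n sum_n_Reals.
      change (@plus _ ?x (opp ?y)) with (x - y). rewrite -minus_sum. reflexivity.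
  - change (snd (l * m)%C) with (plus (fst l * snd m) (snd l * fst m)).
    eapply is_series_ext; cycle 1.
    + apply: is_series_plus; apply is_series_mult; eassumption.
    + intros n. rewrite snd_sum_n sum_n_Reals.
      change (@plus _) with Rplus. rewrite -sum_plus. reflexivity.
Qed.

(** * Tails, rearrangement and continuity of dominated real series *)

Lemma Series_tail_le (u v : nat -> R) (N : nat) :
  (forall n, (n <= N)%nat -> u n = 0) -> (forall n, Rabs (u n) <= v n) -> ex_series v ->
  Rabs (Series u) <= Series v - sum_n v N.
Proof.
  intros H0 Huv Hv.
  assert (Hu : ex_series (fun n => Rabs (u n))).
  { apply: ex_series_le; [|exact Hv]. intros n. rewrite /norm /= /abs /= Rabs_Rabsolu. apply Huv. }
  rewrite (Series_incr_n u (S N)); [|lia|now apply ex_series_Rabs].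
  rewrite (Series_incr_n v (S N)); [|lia|exact Hv].
  rewrite sum_n_Reals. change (pred (S N)) with N.
  rewrite (sum_eq_R0 u N); [|intros n Hn; now apply H0].
  rewrite Rplus_0_l.
  apply (ex_series_incr_n _ (S N)) in Hu. apply (ex_series_incr_n _ (S N)) in Hv.
  apply Rle_trans with (Series (fun k => v (S N + k)%nat)); [|lra].
  eapply Rle_trans; [apply Series_Rabs; exact Hu|].
  apply Series_le; [|exact Hv]. intros n. split; [apply Rabs_pos | apply Huv].
Qed.

Lemma is_lim_seq_Series_tail (v : nat -> R) :
  ex_series v -> is_lim_seq (fun N => Series v - sum_n v N) 0.
Proof.
  intros Hv. replace (Finite 0) with (Finite (Series v - Series v)) by (f_equal; ring).
  apply is_lim_seq_minus'; [apply is_lim_seq_const|].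
  exact (Series_correct _ Hv).
Qed.

Lemma is_series_of_tail (u e : nat -> R) (l : R) :
  (forall N, Rabs (sum_n u N - l) <= e N) -> is_lim_seq e 0 -> is_series u l.
Proof.
  intros Hu He.
  change (is_lim_seq (sum_n u) l).
  apply is_lim_seq_ext with (fun N => (sum_n u N - l) + l); [intros; ring|].
  replace (Finite l) with (Finite (0 + l)) by (f_equal; ring).
  apply is_lim_seq_plus'; [|apply is_lim_seq_const].
  apply is_lim_seq_abs_0. 
  refine (is_lim_seq_le_le (fun _ => 0) _ e 0 _ (is_lim_seq_const 0) He).
  intros n. split; [apply Rabs_pos | apply Hu].
Qed.

(** Adding the columns up to [N] amounts to truncating every row at [N]. Since [d] is lower
    triangular, the rows [n <= N] are already complete, and each later row is off by at most
    [2 * v n]. The error is therefore at most twice a tail of [v]. *)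
Lemma is_series_double (d : nat -> nat -> R) (v : nat -> R) (l : R) :
  ex_series v -> (forall n N, sum_n (fun m => Rabs (d n m)) N <= v n) ->
  (forall n m, (n < m)%nat -> d n m = 0) ->
  is_series (fun n => sum_n (d n) n) l ->
  is_series (fun m => Series (fun n => d n m)) l.
Proof.
  intros Hv Hd H0 Hl.
  assert (Ecol : forall m, ex_series (fun n => d n m)).
  { intros m. apply: ex_series_le; [|exact Hv]. intros n. simpl.
    eapply Rle_trans; [|apply (Hd n m)].
    destruct m as [|m]; [rewrite sum_O; apply Rle_refl|].
    rewrite sum_Sn. change (@plus _) with Rplus. 
    assert (0 <= sum_n (fun m0 => Rabs (d n m0)) m).
    { rewrite sum_n_Reals. apply cond_pos_sum. intros; apply Rabs_pos. }
    change (norm (d n (S m))) with (Rabs (d n (S m))). lra. }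
  assert (Esum : forall N, is_series (fun n => sum_n (d n) N)
                             (sum_n (fun m => Series (fun n => d n m)) N)).
  { induction N as [|N IH].
    - rewrite sum_O. apply is_series_ext with (fun n => d n 0%nat).
      { intros n. now rewrite sum_O. } apply Series_correct, Ecol.
    - rewrite sum_Sn. apply is_series_ext with (fun n => plus (sum_n (d n) N) (d n (S N))).
      { intros n. now rewrite sum_Sn. } apply: is_series_plus; [exact IH|].
      apply Series_correct, Ecol. }
  assert (Hpos : forall n, 0 <= v n).
  { intros n. eapply Rle_trans; [apply Rabs_pos|]. specialize (Hd n 0%nat).
    rewrite sum_O in Hd. exact Hd. }
  assert (Hsum : forall n N, Rabs (sum_n (d n) N) <= v n).
  { intros n N. eapply Rle_trans; [|apply (Hd n N)]. rewrite !sum_n_Reals. apply Rsum_abs. }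
  assert (Hstab : forall n N, (n <= N)%nat -> sum_n (d n) N = sum_n (d n) n).
  { intros n N HN. induction HN as [|N HN IH]; [reflexivity|].
    rewrite sum_Sn IH H0; [|lia]. change (@plus _) with Rplus. apply Rplus_0_r. }
  assert (Herr : forall N, Rabs (sum_n (fun m => Series (fun n => d n m)) N - l)
                    <= 2 * (Series v - sum_n v N)).
  { intros N.
    pose proof (is_series_minus _ _ _ _ (Esum N) Hl) as HD.
    replace (_ - l) with (Series (fun n => sum_n (d n) N - sum_n (d n) n))
      by exact (is_series_unique _ _ HD).
    replace (2 * (Series v - sum_n v N))
      with (Series (fun n => 2 * v n) - sum_n (fun n => 2 * v n) N);
      [|rewrite Series_scal_l !sum_n_Reals; 
        rewrite -(sum_eq (fun n => v n * 2)); [rewrite -scal_sum; ring | intros; ring]].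
    apply Series_tail_le.
    - intros n Hn. rewrite (Hstab n N Hn). now apply Rminus_diag_eq.
    - intros n. unfold Rminus.
      eapply Rle_trans; [apply Rabs_triang|]. rewrite Rabs_Ropp.
      pose proof (Hsum n N). pose proof (Hsum n n). lra.
    - apply (ex_series_scal_l 2 v Hv). }
  apply (is_series_of_tail _ _ _ Herr).
  replace (Finite 0) with (Rbar_mult 2 0) by (simpl; f_equal; ring).
  apply is_lim_seq_scal_l, is_lim_seq_Series_tail, Hv.
Qed.

(** The Weierstrass M-test: on the ball, the tails of [v] bound the error of the partial sums
    uniformly. *)
Lemma continuous_Series (u : nat -> R -> R) (v : nat -> R) (t : R) (d : posreal) :
  (forall n s, Rabs (s - t) < d -> Rabs (u n s) <= v n) -> ex_series v ->
  (forall n s, Rabs (s - t) < d -> continuous (u n) s) ->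
  continuous (fun s => Series (fun n => u n s)) t.
Proof.
  intros Hu Hv Hc. apply continuity_pt_filterlim.
  apply (CVU_continuity (fun N s => sum_n (fun n => u n s) N) _ t d).
  - intros eps Heps.
    pose proof (is_lim_seq_Series_tail v Hv) as HL.
    apply is_lim_seq_spec in HL. destruct (HL (mkposreal eps Heps)) as [N HN].
    exists N. intros n y Hn Hy. specialize (HN n Hn). simpl in HN. rewrite Rminus_0_r in HN.
    eapply Rle_lt_trans; [|eapply Rle_lt_trans; [apply Rle_abs|exact HN]].
    assert (Ey : ex_series (fun k => u k y)).
    { apply: ex_series_le; [|exact Hv]. intros k. apply Hu. exact Hy. }
    assert (Eyn : ex_series (fun k => Rabs (u (S n + k)%nat y))).
    { apply: ex_series_le; [|exact (proj1 (ex_series_incr_n v (S n)) Hv)].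
      intros k. rewrite /norm /= /abs /= Rabs_Rabsolu. apply Hu. exact Hy. }
    rewrite (Series_incr_n (fun k => u k y) (S n)); [|lia|exact Ey].
    rewrite (Series_incr_n v (S n)); [|lia|exact Hv].
    rewrite !sum_n_Reals. change (pred (S n)) with n.
    replace (_ + _ - _) with (Series (fun k => u (S n + k)%nat y)) by ring.
    replace (_ + _ - _) with (Series (fun k => v (S n + k)%nat)) by ring.
    eapply Rle_trans; [apply Series_Rabs; exact Eyn|].
    apply Series_le; [|exact (proj1 (ex_series_incr_n v (S n)) Hv)].
    intros k. split; [apply Rabs_pos|]. apply Hu. exact Hy.
  - intros n y Hy. apply continuity_pt_filterlim.
    induction n as [|n IH].
    + apply continuous_ext with (u 0%nat); [intros; now rewrite sum_O|]. now apply Hc.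
    + apply continuous_ext with (fun s => plus (sum_n (fun k => u k s) n) (u (S n) s));
        [intros; now rewrite sum_Sn|].
      apply: continuous_plus; [exact IH | now apply Hc].
  - unfold Boule. rewrite Rminus_eq_0 Rabs_R0. apply cond_pos.
Qed.

(** * Continuity of complex-valued functions and uniqueness of expansions *)

Definition Ccontinuous (f : R -> C) (t : R) : Prop :=
  continuous (fun s => fst (f s)) t /\ continuous (fun s => snd (f s)) t.

Lemma Ccontinuous_ext_loc (f g : R -> C) (t : R) :
  locally t (fun s => f s = g s) -> Ccontinuous f t -> Ccontinuous g t.
Proof.
  intros E [H1 H2]. split.
  - apply (continuous_ext_loc _ (fun s => fst (f s))); [|exact H1].
    revert E. apply filter_imp. intros s Hs. now rewrite Hs.
  - apply (continuous_ext_loc _ (fun s => snd (f s))); [|exact H2].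
    revert E. apply filter_imp. intros s Hs. now rewrite Hs.
Qed.

Lemma Ccontinuous_const (c : C) (t : R) : Ccontinuous (fun _ => c) t.
Proof. split; apply continuous_const. Qed.

Lemma Ccontinuous_RtoC (f : R -> R) (t : R) : continuous f t -> Ccontinuous (fun s => RtoC (f s)) t.
Proof. intros H. split; [exact H | apply continuous_const]. Qed.

Lemma Ccontinuous_plus (f g : R -> C) (t : R) :
  Ccontinuous f t -> Ccontinuous g t -> Ccontinuous (fun s => f s + g s)%C t.
Proof. intros [F1 F2] [G1 G2]. split; simpl; apply: continuous_plus; assumption. Qed.

Lemma Ccontinuous_mult (f g : R -> C) (t : R) :
  Ccontinuous f t -> Ccontinuous g t -> Ccontinuous (fun s => f s * g s)%C t.
Proof.
  intros [F1 F2] [G1 G2]. split; simpl.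
  - apply: continuous_minus; apply: continuous_mult; assumption.
  - apply: continuous_plus; apply: continuous_mult; assumption.
Qed.

Lemma Ccontinuous_comp (f : R -> C) (phi : R -> R) (t : R) :
  continuous phi t -> Ccontinuous f (phi t) -> Ccontinuous (fun s => f (phi s)) t.
Proof.
  intros Hp [F1 F2].
  split; [apply (continuous_comp phi (fun s => fst (f s)))
         |apply (continuous_comp phi (fun s => snd (f s)))]; assumption.
Qed.

Lemma Ccontinuous_sum_n (u : nat -> R -> C) (n : nat) (t : R) :
  (forall i, Ccontinuous (u i) t) -> Ccontinuous (fun s => @sum_n C_AbelianMonoid (fun i => u i s) n) t.
Proof.
  intros H. induction n as [|n IH].
  - eapply Ccontinuous_ext_loc; [|apply (H 0%nat)]. apply filter_forall. intros s. now rewrite sum_O.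
  - eapply Ccontinuous_ext_loc; [|apply (Ccontinuous_plus _ _ _ IH (H (S n)))].
    apply filter_forall. intros s. now rewrite sum_Sn.
Qed.

Definition Csum (u : nat -> C) : C :=
  (Series (fun n => fst (u n)), Series (fun n => snd (u n))).

Lemma Csum_unique (u : nat -> C) (l : C) : is_Cseries u l -> Csum u = l.
Proof.
  intros [H1 H2]. unfold Csum.
  rewrite (is_series_unique _ _ H1) (is_series_unique _ _ H2). now destruct l.
Qed.

Lemma Csum_correct (u : nat -> C) (v : nat -> R) :
  (forall n, Cmod (u n) <= v n) -> ex_series v -> is_Cseries u (Csum u).
Proof.
  intros Hu Hv. destruct (is_Cseries_abs u v Hu Hv) as [l Hl].
  now rewrite (Csum_unique _ _ Hl).
Qed.

Lemma is_Cseries_unique (u : nat -> C) (l m : C) : is_Cseries u l -> is_Cseries u m -> l = m.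
Proof. intros H1 H2. now rewrite -(Csum_unique _ _ H1) (Csum_unique _ _ H2). Qed.

Lemma Ccontinuous_Csum (u : nat -> R -> C) (v : nat -> R) (t : R) (d : posreal) :
  (forall n s, Rabs (s - t) < d -> Cmod (u n s) <= v n) -> ex_series v ->
  (forall n s, Rabs (s - t) < d -> Ccontinuous (u n) s) ->
  Ccontinuous (fun s => Csum (fun n => u n s)) t.
Proof.
  intros Hu Hv Hc. split; simpl; apply continuous_Series with v d; try exact Hv.
  - intros n s Hs. eapply Rle_trans; [apply re_le_Cmod | now apply Hu].
  - intros n s Hs. now apply Hc.
  - intros n s Hs. eapply Rle_trans; [apply im_le_Cmod | now apply Hu].
  - intros n s Hs. now apply Hc.
Qed.

Lemma CV_radius_gt (a : nat -> R) (r x : R) :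
  (forall y, Rabs y < r -> ex_series (fun n => a n * y ^ n)) -> 0 <= x < r ->
  Rbar_lt x (CV_radius a).
Proof.
  intros Ha Hx.
  (* The midpoint gives the strict inequality: beyond the radius of convergence the terms would not
     tend to 0, although the series converges at every point below [r]. *)
  apply Rbar_lt_le_trans with ((x + r) / 2); [simpl; lra|].
  apply Rbar_not_lt_le. intros HC.
  assert (E : Rabs ((x + r) / 2) = (x + r) / 2) by (apply Rabs_pos_eq; lra).
  rewrite -E in HC.
  apply (CV_disk_outside _ _ HC). apply: ex_series_lim_0. apply Ha. rewrite E. lra.
Qed.

Lemma is_Cseries_real_pow (a : nat -> C) (x : R) (l : C) :
  is_Cseries (fun n => a n * RtoC x ^ n)%C l ->
  is_series (fun n => fst (a n) * x ^ n) (fst l) /\ is_series (fun n => snd (a n) * x ^ n) (snd l).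
Proof.
  intros [H1 H2]. split.
  - eapply is_series_ext; [|exact H1]. intros n. simpl. rewrite -RtoC_pow. simpl. ring.
  - eapply is_series_ext; [|exact H2]. intros n. simpl. rewrite -RtoC_pow. simpl. ring.
Qed.

(** At real arguments both components are real power series, and these are determined by their sums
    near 0. The lemma serves to identify expansions that were chosen independently of each other. *)
Lemma is_Cseries_pow_ext (a b : nat -> C) (g : C -> C) (r : R) : 0 < r ->
  (forall z, Cmod z < r -> is_Cseries (fun n => a n * z ^ n)%C (g z)) ->
  (forall z, Cmod z < r -> is_Cseries (fun n => b n * z ^ n)%C (g z)) ->
  forall n, a n = b n.
Proof.
  intros Hr Ha Hb n.
  assert (Ha' : forall x, Rabs x < r -> _) by
    (intros x Hx; apply (is_Cseries_real_pow a x (g (RtoC x))), Ha; now rewrite Cmod_R).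
  assert (Hb' : forall x, Rabs x < r -> _) by
    (intros x Hx; apply (is_Cseries_real_pow b x (g (RtoC x))), Hb; now rewrite Cmod_R).
  assert (Hloc : locally 0 (fun x => Rabs x < r)).
  { exists (mkposreal r Hr). intros x Hx.
    change (Rabs (x - 0) < r) in Hx. now rewrite Rminus_0_r in Hx. }
  apply injective_projections.
  - apply (PSeries_ext_recip (fun n => fst (a n)) (fun n => fst (b n))).
    + apply CV_radius_gt with r; [|lra]. intros y Hy. eexists. apply (Ha' y Hy).
    + apply CV_radius_gt with r; [|lra]. intros y Hy. eexists. apply (Hb' y Hy).
    + revert Hloc. apply filter_imp. intros x Hx. unfold PSeries.
      now rewrite (is_series_unique _ _ (proj1 (Ha' x Hx))) (is_series_unique _ _ (proj1 (Hb' x Hx))).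
  - apply (PSeries_ext_recip (fun n => snd (a n)) (fun n => snd (b n))).
    + apply CV_radius_gt with r; [|lra]. intros y Hy. eexists. apply (Ha' y Hy).
    + apply CV_radius_gt with r; [|lra]. intros y Hy. eexists. apply (Hb' y Hy).
    + revert Hloc. apply filter_imp. intros x Hx. unfold PSeries.
      now rewrite (is_series_unique _ _ (proj2 (Ha' x Hx))) (is_series_unique _ _ (proj2 (Hb' x Hx))).
Qed.

Lemma Cmod_le_Rabs (z : C) : Cmod z <= Rabs (fst z) + Rabs (snd z).
Proof.
  unfold Cmod. apply Rsqr_incr_0_var.
  - rewrite Rsqr_sqrt; [|nra]. unfold Rsqr.
    pose proof (Rabs_pos (fst z)). pose proof (Rabs_pos (snd z)).
    rewrite -(pow2_abs (fst z)) -(pow2_abs (snd z)). nra.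
  - pose proof (Rabs_pos (fst z)). pose proof (Rabs_pos (snd z)). lra.
Qed.

(** Convergence at real points alone bounds from below the radii of the two component series, inside
    which convergence is absolute; the modulus is at most the sum of the components. *)
Lemma ex_series_Cmod_pow (a : nat -> C) (g : C -> C) (r x : R) :
  (forall z, Cmod z < r -> is_Cseries (fun n => a n * z ^ n)%C (g z)) -> 0 <= x < r ->
  ex_series (fun n => Cmod (a n) * x ^ n).
Proof.
  intros Ha Hx.
  assert (Ha' : forall x, Rabs x < r -> _) by
    (intros y Hy; apply (is_Cseries_real_pow a y (g (RtoC y))), Ha; now rewrite Cmod_R).
  assert (Rx : Rabs x = x) by (apply Rabs_pos_eq; lra).
  assert (H1 : ex_series (fun n => Rabs (fst (a n) * x ^ n))).
  { apply (CV_disk_inside (fun n => fst (a n))). rewrite Rx.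
    apply CV_radius_gt with r; [|lra]. intros y Hy. eexists. apply (Ha' y Hy). }
  assert (H2 : ex_series (fun n => Rabs (snd (a n) * x ^ n))).
  { apply (CV_disk_inside (fun n => snd (a n))). rewrite Rx.
    apply CV_radius_gt with r; [|lra]. intros y Hy. eexists. apply (Ha' y Hy). }
  apply: ex_series_le; [|apply (ex_series_plus _ _ H1 H2)].
  intros n. change (Rabs (Cmod (a n) * x ^ n) <= Rabs (fst (a n) * x ^ n) + Rabs (snd (a n) * x ^ n)).
  assert (0 <= x ^ n) by (apply pow_le; lra).
  rewrite !Rabs_mult (Rabs_pos_eq (x ^ n)) // (Rabs_pos_eq (Cmod _)); [|apply Cmod_ge_0].
  rewrite -Rmult_plus_distr_r. apply Rmult_le_compat_r; [assumption|apply Cmod_le_Rabs].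
Qed.

(** * Recentering a power series *)

(* [ring] does not see through the carrier of [C_AbelianMonoid] in the type of an equation. *)
Ltac cring := match goal with |- @eq _ ?a ?b => change (@eq C a b) end; ring.

(* [affpow t h n m] is the coefficient of [z ^ m] in [(t z + h) ^ n]. *)
Fixpoint affpow (t h : C) (n m : nat) : C :=
  match n, m with
  | O, O => RtoC 1
  | O, S _ => RtoC 0
  | S n, O => (h * affpow t h n 0)%C
  | S n, S m => (t * affpow t h n m + h * affpow t h n (S m))%C
  end.

Lemma affpow_gt (t h : C) (n m : nat) : (n < m)%nat -> affpow t h n m = 0.
Proof.
  revert m. induction n as [|n IH]; intros [|m] Hm; try lia; simpl; [reflexivity|].
  rewrite !IH; try lia. ring.
Qed.

Lemma csum_S (u : nat -> C) (n : nat) :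
  @sum_n C_AbelianMonoid u (S n) = (@sum_n C_AbelianMonoid u n + u (S n))%C.
Proof. apply: sum_Sn. Qed.

Lemma csum_O (u : nat -> C) : @sum_n C_AbelianMonoid u 0 = u 0%nat.
Proof. apply: sum_O. Qed.

Lemma sum_affpow (t h z : C) (n N : nat) : (n <= N)%nat ->
  @sum_n C_AbelianMonoid (fun m => affpow t h n m * z ^ m)%C N = ((t * z + h) ^ n)%C.
Proof.
  (* Multiplying by [t * z + h] leaves the [h] part in place and shifts the [t * z] part by one
     index; hence the second sum stops one index earlier. This holds for every truncation, whatever
     its position relative to the degree. *)
  assert (Hrec : forall n N,
    @sum_n C_AbelianMonoid (fun m => affpow t h (S n) m * z ^ m)%C (S N)
    = (h * @sum_n C_AbelianMonoid (fun m => affpow t h n m * z ^ m) (S N)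
       + t * z * @sum_n C_AbelianMonoid (fun m => affpow t h n m * z ^ m) N)%C).
  { intros p M. induction M as [|M IH].
    - rewrite !csum_S !csum_O. simpl. cring.
    - rewrite csum_S IH (csum_S _ (S M)) (csum_S _ M).
      change (affpow t h (S p) (S (S M)))
        with (t * affpow t h p (S M) + h * affpow t h p (S (S M)))%C.
      rewrite (Cpow_S z (S M)). cring. }
  revert N. induction n as [|n IH]; intros N HN.
  - clear HN. induction N as [|N IHN]; [rewrite csum_O; simpl; cring|].
    rewrite csum_S IHN. simpl. cring.
  - destruct N as [|N]; [lia|]. rewrite Hrec !IH; try lia. simpl. cring.
Qed.

(** The triangle inequality turns the recursion of [affpow] into one for the moduli, dominated by
    the binomial recursion of [(Cmod t * x + Cmod h) ^ n]. *)
Lemma sum_affpow_le (t h : C) (x : R) (n N : nat) : 0 <= x ->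
  sum_n (fun m => Cmod (affpow t h n m) * x ^ m) N <= (Cmod t * x + Cmod h) ^ n.
Proof.
  intros Hx.
  pose proof (Cmod_ge_0 t) as Ht. pose proof (Cmod_ge_0 h) as Hh.
  assert (Htx : 0 <= Cmod t * x) by (apply Rmult_le_pos; assumption).
  set (T := fun n N => sum_n (fun m => Cmod (affpow t h n m) * x ^ m) N).
  assert (HO : forall n, T n 0%nat = Cmod (affpow t h n 0)).
  { intros p. unfold T. rewrite sum_O. simpl. apply Rmult_1_r. }
  assert (HS : forall n N, T n (S N) = T n N + Cmod (affpow t h n (S N)) * (x * x ^ N)).
  { intros p M. apply: sum_Sn. }
  assert (HC : forall n N, Cmod (affpow t h (S n) (S N))
     <= Cmod t * Cmod (affpow t h n N) + Cmod h * Cmod (affpow t h n (S N))).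
  { intros p M. simpl. eapply Rle_trans; [apply Cmod_triangle|].
    rewrite !Cmod_mult. apply Rle_refl. }
  assert (HC0 : forall n, Cmod (affpow t h (S n) 0) = Cmod h * Cmod (affpow t h n 0)).
  { intros p. apply Cmod_mult. }
  assert (Hrec : forall n N, T (S n) (S N) <= Cmod h * T n (S N) + Cmod t * x * T n N).
  { intros p M. clearbody T. induction M as [|M IH].
    - rewrite !HS !HO HC0. specialize (HC p 0%nat). simpl pow. nra.
    - rewrite (HS (S p)) (HS p (S M)).
      assert (Hx2 : 0 <= x * x ^ S M) by (apply (pow_le x (S (S M))); assumption).
      pose proof (Rmult_le_compat_r _ _ _ Hx2 (HC p (S M))) as H.
      assert (E : Cmod t * x * T p (S M)
        = Cmod t * x * T p M + Cmod t * Cmod (affpow t h p (S M)) * (x * x ^ S M))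
        by (rewrite (HS p M); simpl; ring).
      nra. }
  assert (Hpos : forall n N, 0 <= T n N).
  { intros. unfold T. rewrite sum_n_Reals. apply cond_pos_sum. intros.
    apply Rmult_le_pos; [apply Cmod_ge_0 | now apply pow_le]. }
  change (T n N <= (Cmod t * x + Cmod h) ^ n). clearbody T.
  revert N. induction n as [|n IH]; intros N.
  - induction N as [|N IHN].
    + rewrite HO. simpl. rewrite Cmod_1. lra.
    + rewrite HS. simpl in *. rewrite Cmod_0. lra.
  - assert (0 <= (Cmod t * x + Cmod h) ^ n) by (apply pow_le; lra).
    change ((Cmod t * x + Cmod h) ^ S n)
      with ((Cmod t * x + Cmod h) * (Cmod t * x + Cmod h) ^ n). destruct N as [|N].
    + rewrite HO HC0. specialize (IH 0%nat). rewrite HO in IH. nra.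
    + eapply Rle_trans; [apply Hrec|]. pose proof (IH N). pose proof (IH (S N)).
      pose proof (Hpos n N). pose proof (Hpos n (S N)). nra.
Qed.

Lemma Ccontinuous_affpow (tt hh : R -> C) (s : R) (n m : nat) :
  Ccontinuous tt s -> Ccontinuous hh s -> Ccontinuous (fun s => affpow (tt s) (hh s) n m) s.
Proof.
  intros Ht Hh. revert m. induction n as [|n IH]; intros [|m]; simpl.
  - apply Ccontinuous_const.
  - apply Ccontinuous_const.
  - now apply Ccontinuous_mult.
  - now apply Ccontinuous_plus; apply Ccontinuous_mult.
Qed.

Lemma Cmod_affpow_le (t h : C) (x y : R) (n m : nat) : 0 < x -> Cmod t * x + Cmod h <= y ->
  Cmod (affpow t h n m) * x ^ m <= y ^ n.
Proof.
  intros Hx Hy.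
  assert (H0 : 0 <= Cmod t * x) by (apply Rmult_le_pos; [apply Cmod_ge_0|lra]).
  pose proof (Cmod_ge_0 h) as H1.
  apply Rle_trans with ((Cmod t * x + Cmod h) ^ n); [|apply pow_incr; lra].
  eapply Rle_trans; [|apply (sum_affpow_le t h x n m); lra].
  destruct m as [|m]; [rewrite sum_O; apply Rle_refl|].
  rewrite sum_Sn. change (@plus _) with Rplus.
  assert (0 <= sum_n (fun m => Cmod (affpow t h n m) * x ^ m) m); [|lra].
  rewrite sum_n_Reals. apply cond_pos_sum. intros.
  apply Rmult_le_pos; [apply Cmod_ge_0 | apply pow_le; lra].
Qed.

(** The affine map sending [z] to [t * z + h] carries the disc of radius [x] into the disc of radius
    [y], where the original series converges absolutely. Expanding each power gives a triangular
    double series whose [n]-th row is bounded by [Cmod (a n) * y ^ n], so rows and columns may be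
    exchanged. *)
Lemma is_Cseries_recenter (a : nat -> C) (t h z l : C) (x y : R) :
  0 < x -> Cmod t * x + Cmod h <= y -> ex_series (fun n => Cmod (a n) * y ^ n) ->
  Cmod z <= x -> is_Cseries (fun n => a n * (t * z + h) ^ n)%C l ->
  is_Cseries (fun m => Csum (fun n => a n * affpow t h n m) * z ^ m)%C l.
Proof.
  intros Hx Hy Ha Hz Hl.
  set (d := fun n m => (a n * affpow t h n m * z ^ m)%C).
  assert (Hd : forall n N, sum_n (fun m => Cmod (d n m)) N <= Cmod (a n) * y ^ n).
  { intros n N. unfold d.
    apply Rle_trans with (sum_n (fun m => Cmod (a n) * (Cmod (affpow t h n m) * x ^ m)) N).
    - apply sum_n_m_le. intros m. rewrite !Cmod_mult Cmod_pow Rmult_assoc.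
      apply Rmult_le_compat_l; [apply Cmod_ge_0|].
      apply Rmult_le_compat_l; [apply Cmod_ge_0|]. apply pow_incr. split; [apply Cmod_ge_0|exact Hz].
    - rewrite sum_n_Reals -(sum_eq (fun m => (Cmod (affpow t h n m) * x ^ m) * Cmod (a n)));
        [|intros; ring]. rewrite -scal_sum.
      apply Rmult_le_compat_l; [apply Cmod_ge_0|]. rewrite -sum_n_Reals.
      eapply Rle_trans; [apply sum_affpow_le; lra|]. apply pow_incr. split; [|exact Hy].
      pose proof (Cmod_ge_0 t). pose proof (Cmod_ge_0 h). nra. }
  assert (Hcol : forall m, (Csum (fun n => a n * affpow t h n m) * z ^ m)%C
                   = Csum (fun n => d n m)).
  { intros m. symmetry. apply Csum_unique.
    rewrite Cmult_comm. apply is_Cseries_ext with (fun n => z ^ m * (a n * affpow t h n m))%C.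
    { intros n. unfold d. ring. }
    apply is_Cseries_scal. apply Csum_correct with (fun n => / x ^ m * (Cmod (a n) * y ^ n)).
    - intros n. rewrite Cmod_mult.
      assert (0 < x ^ m) by now apply pow_lt.
      apply Rle_trans with (/ x ^ m * (Cmod (a n) * (Cmod (affpow t h n m) * x ^ m)));
        [right; field; lra|].
      apply Rmult_le_compat_l; [left; now apply Rinv_0_lt_compat|].
      apply Rmult_le_compat_l; [apply Cmod_ge_0|]. now apply Cmod_affpow_le.
    - apply (ex_series_scal_l (/ x ^ m) _ Ha). }
  apply is_Cseries_ext with (fun m => Csum (fun n => d n m)); [intros m; now rewrite Hcol|].
  assert (Hrow : forall n, (a n * (t * z + h) ^ n)%C = @sum_n C_AbelianMonoid (d n) n).
  { intros n. rewrite -(sum_affpow t h z n n) //.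
    assert (HN : forall N, (a n * @sum_n C_AbelianMonoid (fun m => affpow t h n m * z ^ m) N)%C
                   = @sum_n C_AbelianMonoid (d n) N); [|apply HN].
    induction N as [|N IH]; unfold d in *.
    - rewrite !csum_O. cring.
    - rewrite !csum_S -IH. cring. }
  assert (H0 : forall n m, (n < m)%nat -> d n m = 0).
  { intros n m Hm. unfold d. rewrite affpow_gt //. ring. }
  clearbody d. destruct Hl as [L1 L2]. split; cbn [fst snd Csum].
  - apply is_series_double with (fun n => Cmod (a n) * y ^ n); [exact Ha| | |].
    + intros n N. eapply Rle_trans; [|apply (Hd n N)]. apply sum_n_m_le.
      intros k; apply (re_le_Cmod (d n k)).
    + intros n m Hm. now rewrite H0.
    + eapply is_series_ext; [|exact L1]. intros n. now rewrite -fst_sum_n -Hrow.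
  - apply is_series_double with (fun n => Cmod (a n) * y ^ n); [exact Ha| | |].
    + intros n N. eapply Rle_trans; [|apply (Hd n N)]. apply sum_n_m_le.
      intros k; apply (im_le_Cmod (d n k)).
    + intros n m Hm. now rewrite H0.
    + eapply is_series_ext; [|exact L2]. intros n. now rewrite -snd_sum_n -Hrow.
Qed.

(** * Expansions depending on a parameter *)

(** The first clause is a Cauchy estimate. The second concerns [c] in a neighbourhood of [s], while
    the other two speak of the single parameter [s]. *)
Definition expands (f : R -> C -> C) (w0 : C) (rho M : R) (c : R -> nat -> C) (s : R) : Prop :=
  (forall n, Cmod (c s n) * rho ^ n <= M) /\
  (forall n, Ccontinuous (fun s => c s n) s) /\
  (forall z, Cmod z < rho -> is_Cseries (fun n => c s n * z ^ n)%C (f s (w0 + z)%C)).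

(** The order of quantifiers is the point: [rho], [M] and the family [c] are common to all
    parameters, which is what permits integration in [s] under the power series. *)
Definition unif_analytic (f : R -> C -> C) (w0 : C) : Prop :=
  exists (rho M : R) (c : R -> nat -> C), 0 < rho /\
    forall s, 0 < s < 1 -> expands f w0 rho M c s.

Lemma Cmod_pow_le_geom (a z : C) (rho M : R) (n : nat) : 0 < rho ->
  Cmod a * rho ^ n <= M -> Cmod (a * z ^ n)%C <= M * (Cmod z / rho) ^ n.
Proof.
  intros Hr Ha. rewrite Cmod_mult Cmod_pow.
  assert (Hp : 0 < rho ^ n) by now apply pow_lt.
  unfold Rdiv. rewrite Rpow_mult_distr pow_inv.
  replace (Cmod a * Cmod z ^ n) with (Cmod a * rho ^ n * (Cmod z ^ n * / rho ^ n)) by (field; lra).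
  apply Rmult_le_compat_r; [|exact Ha].
  apply Rmult_le_pos; [apply pow_le, Cmod_ge_0 | left; now apply Rinv_0_lt_compat].
Qed.

Lemma ex_series_geom_scal (M x rho : R) : 0 < rho -> 0 <= x < rho ->
  ex_series (fun n => M * (x / rho) ^ n).
Proof.
  intros Hr Hx. apply (ex_series_scal_l M (fun n => (x / rho) ^ n)). apply ex_series_geom.
  assert (0 <= x / rho) by (apply Rdiv_le_0_compat; lra).
  rewrite Rabs_pos_eq //. apply Rlt_div_l; lra.
Qed.

Lemma unif_analytic_shrink (f : R -> C -> C) (w0 : C) (rho rho' M : R) (c : R -> nat -> C) (s : R) :
  0 < rho' <= rho -> expands f w0 rho M c s -> expands f w0 rho' M c s.
Proof.
  intros Hr [H1 [H2 H3]]. split; [|split; [exact H2|]].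
  - intros n. eapply Rle_trans; [|apply (H1 n)].
    apply Rmult_le_compat_l; [apply Cmod_ge_0|]. apply pow_incr. lra.
  - intros z Hz. apply H3. lra.
Qed.

(** The coefficients of the Cauchy product are sums of [n + 1] terms, each at most
    [M1 * M2 / r ^ n]. Halving the radius absorbs the factor, since [n + 1 <= 2 ^ n]. *)
Lemma unif_analytic_mult (f g : R -> C -> C) (w0 : C) :
  unif_analytic f w0 -> unif_analytic g w0 -> unif_analytic (fun s w => f s w * g s w)%C w0.
Proof.
  intros [r1 [M1 [a [Hr1 Ha]]]] [r2 [M2 [b [Hr2 Hb]]]].
  set (r := Rmin r1 r2).
  assert (Hr : 0 < r) by (now apply Rmin_pos).
  exists (r / 2), (M1 * M2),
    (fun s n => @sum_n C_AbelianMonoid (fun i => a s i * b s (n - i)%nat)%C n).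
  split; [lra|]. intros s Hs.
  destruct (unif_analytic_shrink f w0 r1 r M1 a s (conj Hr (Rmin_l _ _)) (Ha s Hs)) as [A1 [A2 A3]].
  destruct (unif_analytic_shrink g w0 r2 r M2 b s (conj Hr (Rmin_r _ _)) (Hb s Hs)) as [B1 [B2 B3]].
  assert (HM1 : 0 <= M1).
  { eapply Rle_trans; [|apply (A1 0%nat)]. simpl. rewrite Rmult_1_r. apply Cmod_ge_0. }
  assert (HM2 : 0 <= M2).
  { eapply Rle_trans; [|apply (B1 0%nat)]. simpl. rewrite Rmult_1_r. apply Cmod_ge_0. }
  split; [|split].
  - intros n.
    assert (H : Cmod (@sum_n C_AbelianMonoid (fun i => a s i * b s (n - i)%nat)%C n) * r ^ n
                <= INR (S n) * (M1 * M2)).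
    { eapply Rle_trans; [apply Rmult_le_compat_r; [apply pow_le; lra|apply Cmod_sum_n]|].
      rewrite Rmult_comm sum_n_Reals scal_sum. rewrite Rmult_comm -sum_cte.
      apply sum_Rle. intros i Hi. rewrite Cmod_mult.
      replace (r ^ n) with (r ^ i * r ^ (n - i)) by (rewrite -pow_add; f_equal; lia).
      replace (_ * _ * _) with ((Cmod (a s i) * r ^ i) * (Cmod (b s (n - i)%nat) * r ^ (n - i))) by ring.
      apply Rmult_le_compat; try apply A1; try apply B1;
        (apply Rmult_le_pos; [apply Cmod_ge_0 | apply pow_le; lra]). }
    assert (H2 : INR (S n) <= 2 ^ n).
    { clear. induction n as [|n IH]; [simpl; lra|]. rewrite S_INR.
      assert (1 <= 2 ^ n) by (apply pow_R1_Rle; lra). simpl. simpl in IH. lra. }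
    unfold Rdiv. rewrite Rpow_mult_distr pow_inv.
    assert (0 < 2 ^ n) by (apply pow_lt; lra).
    apply Rmult_le_reg_r with (2 ^ n); [assumption|].
    replace (_ * (_ * / _) * _)
      with (Cmod (@sum_n C_AbelianMonoid (fun i => a s i * b s (n - i)%nat)%C n) * r ^ n)
      by (field; lra).
    assert (0 <= M1 * M2) by now apply Rmult_le_pos. nra.
  - intros n. apply (Ccontinuous_sum_n (fun i s => a s i * b s (n - i)%nat)%C).
    intros i. now apply Ccontinuous_mult.
  - intros z Hz. pose proof (Cmod_ge_0 z).
    apply is_Cseries_ext with (fun n => @sum_n C_AbelianMonoid
      (fun i => (a s i * z ^ i) * (b s (n - i)%nat * z ^ (n - i)))%C n).
    + intros n. 
      assert (HN : forall N, (N <= n)%nat ->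
        @sum_n C_AbelianMonoid (fun i => (a s i * z ^ i) * (b s (n - i)%nat * z ^ (n - i)))%C N
        = (@sum_n C_AbelianMonoid (fun i => a s i * b s (n - i)%nat)%C N * z ^ n)%C).
      { assert (Hp : forall i, (i <= n)%nat -> (z ^ n = z ^ i * z ^ (n - i))%C).
        { intros i Hi. rewrite -Cpow_add_r. f_equal. lia. }
        induction N as [|N IH]; intros HN.
        - rewrite !csum_O (Hp 0%nat HN). cring.
        - rewrite !csum_S (IH ltac:(lia)) {2}(Hp (S N) HN) (Hp (S N) HN). cring. }
      now apply HN.
    + apply (is_Cseries_mult (fun i => a s i * z ^ i)%C (fun i => b s i * z ^ i)%C);
        [apply A3; lra | apply B3; lra | |].
      * apply: ex_series_le; [|apply (ex_series_geom_scal M1 (Cmod z) r); lra].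
        intros n. change (norm (Cmod (a s n * z ^ n)%C)) with (Rabs (Cmod (a s n * z ^ n)%C)).
        rewrite Rabs_pos_eq; [|apply Cmod_ge_0]. now apply Cmod_pow_le_geom.
      * apply: ex_series_le; [|apply (ex_series_geom_scal M2 (Cmod z) r); lra].
        intros n. change (norm (Cmod (b s n * z ^ n)%C)) with (Rabs (Cmod (b s n * z ^ n)%C)).
        rewrite Rabs_pos_eq; [|apply Cmod_ge_0]. now apply Cmod_pow_le_geom.
Qed.

Lemma unif_analytic_comp (f : R -> C -> C) (phi : R -> R) (w0 : C) :
  (forall s, 0 < s < 1 -> 0 < phi s < 1 /\ continuous phi s) ->
  unif_analytic f w0 -> unif_analytic (fun s => f (phi s)) w0.
Proof.
  intros Hp [r [M [c [Hr Hc]]]]. exists r, M, (fun s => c (phi s)). split; [exact Hr|].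
  intros s Hs. destruct (Hp s Hs) as [H1 H2]. destruct (Hc _ H1) as [C1 [C2 C3]].
  split; [exact C1|]. split; [|exact C3].
  intros n. now apply (Ccontinuous_comp (fun s => c s n)).
Qed.

Lemma is_Cseries_0 (a : nat -> C) : is_Cseries (fun n => a n * RtoC 0 ^ n)%C (a 0%nat).
Proof.
  apply is_Cseries_is_series. unfold is_series.
  apply filterlim_ext with (fun _ => a 0%nat); [|apply filterlim_const].
  induction x as [|n IH]; [rewrite csum_O; simpl; cring|].
  rewrite csum_S -IH. simpl. cring.
Qed.

(** The value at [w0] is the constant coefficient, which is continuous in the parameter. *)
Lemma unif_analytic_continuous (f : R -> C -> C) (w0 : C) (s : R) :
  unif_analytic f w0 -> 0 < s < 1 -> Ccontinuous (fun s => f s w0) s.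
Proof.
  intros [r [M [c [Hr Hc]]]] Hs.
  apply (Ccontinuous_ext_loc (fun s => c s 0%nat)); [|now apply Hc].
  assert (E : locally s (fun y => 0 < y < 1)).
  { apply (open_and _ _ (open_gt 0) (open_lt 1)). exact Hs. }
  revert E. apply filter_imp. intros y Hy.
  destruct (Hc y Hy) as [_ [_ C3]]. specialize (C3 0%C). rewrite Cmod_0 in C3.
  specialize (C3 Hr). rewrite Cplus_0_r in C3.
  apply is_Cseries_unique with (2 := C3). apply is_Cseries_0.
Qed.

(** For [t] near [t0], the displacement [(w0 + z) * t - w0 * t0] equals [t * z + (t - t0) * w0],
    which is affine in [z]. Recentering along it expresses the new coefficients through the fixed
    sequence [a], with an explicit dependence on [t]. *)
Lemma ray_expands (H : C -> C) (w0 : C) (t0 r : R) (a : nat -> C) :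
  0 <= t0 <= 1 -> 0 < r ->
  (forall w, Cmod (w - w0 * RtoC t0)%C < r ->
     is_Cseries (fun n => a n * (w - w0 * RtoC t0) ^ n)%C (H w)) ->
  exists (rho M delta : R) (c : R -> nat -> C), 0 < rho /\ 0 < delta /\
    forall t, Rabs (t - t0) < delta -> expands (fun t w => H (w * RtoC t)%C) w0 rho M c t.
Proof.
  intros Ht0 Hr Ha.
  set (g := fun z => H (z + w0 * RtoC t0)%C).
  assert (Hg : forall z, Cmod z < r -> is_Cseries (fun n => a n * z ^ n)%C (g z)).
  { intros z Hz. unfold g.
    assert (E : (z + w0 * RtoC t0 - w0 * RtoC t0)%C = z) by ring.
    specialize (Ha (z + w0 * RtoC t0)%C). rewrite E in Ha. now apply Ha. }
  pose proof (Cmod_ge_0 w0) as Hw0.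
  assert (Hv : ex_series (fun n => Cmod (a n) * (r / 2) ^ n)).
  { apply ex_series_Cmod_pow with g r; [exact Hg|lra]. }
  (* The first bound gives [Rabs t <= 2], so a disc of radius [r / 8] is mapped into radius [r / 4];
     the second keeps the shift below [r / 4]. Together they stay within [r / 2], where [a]
     converges absolutely. *)
  set (delta := Rmin 1 (r / (4 * (1 + Cmod w0)))).
  assert (Hd : 0 < delta).
  { apply Rmin_pos; [lra|]. apply Rdiv_lt_0_compat; lra. }
  set (h := fun t => (RtoC (t - t0) * w0)%C).
  assert (Hsmall : forall t, Rabs (t - t0) < delta ->
    Cmod (RtoC t) * (r / 8) + Cmod (h t) <= r / 2).
  { intros t Ht.
    assert (H1 : Rabs (t - t0) < 1) by (eapply Rlt_le_trans; [exact Ht|apply Rmin_l]).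
    assert (H2 : Rabs (t - t0) < r / (4 * (1 + Cmod w0)))
      by (eapply Rlt_le_trans; [exact Ht|apply Rmin_r]).
    unfold h. rewrite Cmod_mult !Cmod_R.
    assert (H3 : Rabs t <= 2).
    { apply Rabs_def2 in H1. apply Rabs_le. lra. }
    apply Rlt_div_r in H2; [|lra].
    pose proof (Rabs_pos (t - t0)). nra. }
  exists (r / 8), (Series (fun n => Cmod (a n) * (r / 2) ^ n)), delta,
    (fun t m => Csum (fun n => a n * affpow (RtoC t) (h t) n m)%C).
  split; [lra|]. split; [exact Hd|].
  assert (Hterm : forall t, Rabs (t - t0) < delta -> forall m n,
    Cmod (a n * affpow (RtoC t) (h t) n m)%C * (r / 8) ^ m <= Cmod (a n) * (r / 2) ^ n).
  { intros t Ht m n. rewrite Cmod_mult Rmult_assoc.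
    apply Rmult_le_compat_l; [apply Cmod_ge_0|].
    apply Cmod_affpow_le; [lra | now apply Hsmall]. }
  assert (Hterm' : forall t, Rabs (t - t0) < delta -> forall m n,
    Cmod (a n * affpow (RtoC t) (h t) n m)%C <= / (r / 8) ^ m * (Cmod (a n) * (r / 2) ^ n)).
  { intros t Ht m n. assert (0 < (r / 8) ^ m) by (apply pow_lt; lra).
    apply Rmult_le_reg_r with ((r / 8) ^ m); [assumption|].
    eapply Rle_trans; [now apply Hterm|]. right. field. lra. }
  assert (Hv' : forall m, ex_series (fun n => / (r / 8) ^ m * (Cmod (a n) * (r / 2) ^ n))).
  { intros m. apply (ex_series_scal_l (/ (r / 8) ^ m) _ Hv). }
  intros t Ht. split; [|split].
  - intros m. assert (Hp : 0 < (r / 8) ^ m) by (apply pow_lt; lra).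
    pose proof (Csum_correct _ _ (Hterm' t Ht m) (Hv' m)) as Hc.
    pose proof (is_Cseries_norm_le _ _ _ _ Hc (Hterm' t Ht m) (Series_correct _ (Hv' m))) as Hn.
    rewrite Series_scal_l in Hn.
    apply Rmult_le_reg_l with (/ (r / 8) ^ m); [now apply Rinv_0_lt_compat|].
    eapply Rle_trans; [|exact Hn]. right. field. lra.
  - intros m.
    (* A ball around [t] inside the ball around [t0]: there the same majorant holds and the M-test
       applies. *)
    assert (Hdt : 0 < delta - Rabs (t - t0)) by lra.
    assert (Hin : forall s, Rabs (s - t) < mkposreal _ Hdt -> Rabs (s - t0) < delta).
    { intros s Hs. simpl in Hs. replace (s - t0) with ((s - t) + (t - t0)) by ring.
      eapply Rle_lt_trans; [apply Rabs_triang|]. lra. }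
    apply Ccontinuous_Csum with (fun n => / (r / 8) ^ m * (Cmod (a n) * (r / 2) ^ n)) (mkposreal _ Hdt).
    + intros n s Hs. apply Hterm'. now apply Hin.
    + apply Hv'.
    + intros n s _. apply Ccontinuous_mult; [apply Ccontinuous_const|]. apply Ccontinuous_affpow.
      * apply Ccontinuous_RtoC. apply continuous_id.
      * apply Ccontinuous_mult; [|apply Ccontinuous_const]. apply Ccontinuous_RtoC.
        apply: continuous_minus; [apply continuous_id | apply continuous_const].
  - intros z Hz. apply is_Cseries_recenter with (r / 8) (r / 2); try lra; try assumption.
    + now apply Hsmall.
    + assert (E : (RtoC t * z + h t)%C = ((w0 + z) * RtoC t - w0 * RtoC t0)%C).
      { unfold h. rewrite RtoC_minus. ring. }
      rewrite E. apply Ha. rewrite -E.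
      eapply Rle_lt_trans; [apply Cmod_triangle|]. rewrite Cmod_mult.
      specialize (Hsmall t Ht). pose proof (Cmod_ge_0 (RtoC t)). nra.
Qed.

Lemma functional_choice (A B : Type) (P : A -> B -> Prop) :
  (forall x, exists y, P x y) -> exists f : A -> B, forall x, P x (f x).
Proof.
  intros H. exists (fun x => proj1_sig (constructive_indefinite_description _ (H x))).
  intros x. exact (proj2_sig (constructive_indefinite_description _ (H x))).
Qed.

(** The segment from 0 to [w0] is compact, so the local data of [ray_expands] have a common radius
    and a common bound. Each parameter selects its own local family, and uniqueness of coefficients
    removes the dependence on that selection. *)
Lemma ray_unif_analytic (D : C -> Prop) (H : C -> C) (w0 : C) :
  (forall t, 0 <= t <= 1 -> D (w0 * RtoC t)%C) -> analytic_on D H ->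
  unif_analytic (fun t w => H (w * RtoC t)%C) w0.
Proof.
  intros HD HA.
  set (f := fun t w => H (w * RtoC t)%C).
  assert (Hloc : forall t0, exists X : R * R * R * (R -> nat -> C),
    let '(rho, M, delta, c) := X in
    0 <= t0 <= 1 -> 0 < rho /\ 0 < delta /\
    forall t, Rabs (t - t0) < delta -> expands f w0 rho M c t).
  { intros t0. destruct (classic (0 <= t0 <= 1)) as [Ht0|Ht0].
    - destruct (HA _ (HD t0 Ht0)) as [r [a [Hr Ha]]].
      destruct (ray_expands H w0 t0 r a Ht0 Hr) as [rho [M [delta [c Hc]]]].
      { intros w Hw. apply pseries_is_Cseries. now apply Ha. }
      exists (rho, M, delta, c). now intros _.
    (* Dummy data outside [0,1], so that choice applies to a total function. *)
    - exists (0, 0, 0, fun _ _ => RtoC 0). tauto. }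
  apply functional_choice in Hloc. destruct Hloc as [X HX].
  (* A single gauge records radius, neighbourhood and bound. A positive lower bound [d] for it
     bounds [rho] from below and, through [/ (1 + Rabs M)], bounds [M] above by [/ d]. *)
  set (m := fun t => let '(rho, M, delta, c) := X t in
     Rmin (Rmin rho delta) (/ (1 + Rabs M))).
  assert (Hm : forall t, 0 <= t <= 1 -> 0 < m t).
  { intros t Ht. specialize (HX t). unfold m. destruct (X t) as [[[rho M] delta] c].
    destruct (HX Ht) as [H1 [H2 _]]. apply Rmin_pos; [now apply Rmin_pos|].
    apply Rinv_0_lt_compat. pose proof (Rabs_pos M). lra. }
  set (dl := fun t => match Rlt_dec 0 (m t) with
                      | left h => mkposreal _ h | right _ => mkposreal 1 Rlt_0_1 end).
  assert (Hdl : forall t, 0 <= t <= 1 -> pos (dl t) = m t).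
  { intros t Ht. unfold dl. destruct (Rlt_dec 0 (m t)) as [h|h]; [reflexivity|].
    exfalso. now apply h, Hm. }
  destruct (compactness_value_1d 0 1 dl) as [d Hd].
  assert (Hx : forall x, exists t, 0 <= x <= 1 ->
     0 <= t <= 1 /\ Rabs (x - t) < m t /\ d <= m t).
  { intros x. destruct (classic (0 <= x <= 1)) as [Hx|Hx]; [|now exists 0].
    destruct (NNPP _ (Hd x Hx)) as [t [Ht Ht']]. exists t. intros _. rewrite -(Hdl t Ht). now split. }
  apply functional_choice in Hx. destruct Hx as [tt Htt].
  assert (Hexp : forall x y, 0 <= x <= 1 -> Rabs (y - tt x) < m (tt x) ->
    expands f w0 d (/ d) (snd (X (tt x))) y).
  { intros x y Hx Hy. destruct (Htt x Hx) as [H1 [H2 H3]]. specialize (HX (tt x)).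
    revert H2 H3 Hy. unfold m. destruct (X (tt x)) as [[[rho M] delta] c].
    intros H2 H3 Hy. destruct (HX H1) as [K1 [K2 K3]].
    assert (Rmin (Rmin rho delta) (/ (1 + Rabs M)) <= rho).
    { eapply Rle_trans; [apply Rmin_l|apply Rmin_l]. }
    assert (Rmin (Rmin rho delta) (/ (1 + Rabs M)) <= delta).
    { eapply Rle_trans; [apply Rmin_l|apply Rmin_r]. }
    assert (HM : d <= / (1 + Rabs M)).
    { eapply Rle_trans; [exact H3|apply Rmin_r]. }
    pose proof (cond_pos d) as Hdp. simpl.
    destruct (unif_analytic_shrink f w0 rho d M c y) as [L1 L2]; [lra|apply K3; lra|].
    split; [|exact L2]. intros n. eapply Rle_trans; [apply L1|].
    pose proof (Rabs_pos M). pose proof (Rle_abs M).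
    apply Rinv_le_contravar in HM; [|assumption]. rewrite Rinv_inv in HM. lra. }
  (* The centre [tt x] may jump with [x]. Near a given [x] the family of the fixed centre [tt x] is
     still valid, and it equals the selected coefficients because both expand the same function; so
     continuity is inherited from it. *)
  exists d, (/ d), (fun x => snd (X (tt x)) x). split; [apply cond_pos|].
  intros x Hx. assert (Hx' : 0 <= x <= 1) by lra.
  destruct (Htt x Hx') as [_ [H2 _]].
  destruct (Hexp x x Hx' H2) as [L1 [L2 L3]].
  split; [exact L1|split; [|exact L3]].
  intros n. apply (Ccontinuous_ext_loc (fun s => snd (X (tt x)) s n)); [|apply L2].
  assert (E1 : locally x (fun y => 0 < y < 1)).
  { apply (open_and _ _ (open_gt 0) (open_lt 1)). exact Hx. }
  assert (Hr : 0 < m (tt x) - Rabs (x - tt x)) by lra.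
  assert (E2 : locally x (fun y => Rabs (y - tt x) < m (tt x))).
  { exists (mkposreal _ Hr). intros y Hy. change (Rabs (y - x) < m (tt x) - Rabs (x - tt x)) in Hy.
    replace (y - tt x) with ((y - x) + (x - tt x)) by ring.
    eapply Rle_lt_trans; [apply Rabs_triang|]. lra. }
  refine (filter_imp _ _ _ (filter_and _ _ E1 E2)). intros y [Hy1 Hy2].
  assert (Hy' : 0 <= y <= 1) by lra.
  destruct (Htt y Hy') as [_ [Hy3 _]].
  apply (is_Cseries_pow_ext (snd (X (tt x)) y) (snd (X (tt y)) y) (fun z => f y (w0 + z)%C) d).
  - apply cond_pos.
  - now apply Hexp.
  - now apply Hexp.
Qed.

(** * Absolutely convergent integrals over (0,1) *)

Definition is_Cint01 (f : R -> C) (l : C) : Prop :=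
  @is_RInt_gen C_R_NormedModule f (at_right 0) (at_left 1) l.

Lemma is_Cint01_components (f : R -> C) (l : C) :
  is_Cint01 f l <->
  is_RInt_gen (fun s => fst (f s)) (at_right 0) (at_left 1) (fst l) /\
  is_RInt_gen (fun s => snd (f s)) (at_right 0) (at_left 1) (snd l).
Proof.
  split.
  - intros H. split; intros P HP.
    + assert (HP' : locally l (fun z : C_R_NormedModule => P (fst z))).
      { destruct HP as [e He]. exists e. intros z [Hz _]. now apply He. }
      specialize (H _ HP'). unfold filtermapi in *. revert H. apply filter_imp.
      intros ab [y [Hy1 Hy2]]. exists (fst y). split; [|exact Hy2].
      apply (is_RInt_fct_extend_fst (U := R_NormedModule) (V := R_NormedModule) f _ _ y Hy1).
    + assert (HP' : locally l (fun z : C_R_NormedModule => P (snd z))).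
      { destruct HP as [e He]. exists e. intros z [_ Hz]. now apply He. }
      specialize (H _ HP'). unfold filtermapi in *. revert H. apply filter_imp.
      intros ab [y [Hy1 Hy2]]. exists (snd y). split; [|exact Hy2].
      apply (is_RInt_fct_extend_snd (U := R_NormedModule) (V := R_NormedModule) f _ _ y Hy1).
  - intros [H1 H2] P [e He].
    specialize (H1 _ (locally_ball _ e)). specialize (H2 _ (locally_ball _ e)).
    unfold filtermapi in *. refine (filter_imp _ _ _ (filter_and _ _ H1 H2)).
    intros ab [[y1 [K1 L1]] [y2 [K2 L2]]]. exists (y1, y2). split.
    + apply (is_RInt_fct_extend_pair (U := R_NormedModule) (V := R_NormedModule) f); assumption.
    + apply He. now split.
Qed.

Lemma is_Cint01_plus (f g : R -> C) (l m : C) :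
  is_Cint01 f l -> is_Cint01 g m -> is_Cint01 (fun s => f s + g s)%C (l + m)%C.
Proof. intros Hf Hg. exact (is_RInt_gen_plus _ _ _ _ Hf Hg). Qed.

Lemma is_Cint01_scal (c : C) (f : R -> C) (l : C) :
  is_Cint01 f l -> is_Cint01 (fun s => c * f s)%C (c * l)%C.
Proof.
  rewrite !is_Cint01_components. intros [H1 H2]. split; simpl.
  - apply: is_RInt_gen_minus; now apply: is_RInt_gen_scal.
  - apply: is_RInt_gen_plus; now apply: is_RInt_gen_scal.
Qed.

(** Separating the endpoints by 1/2 keeps them in increasing order, and the interval between them
    lies inside (0,1). *)
Lemma at_right_left_01 (P : R -> Prop) :
  (forall s, 0 < s < 1 -> P s) ->
  filter_prod (at_right 0) (at_left 1)
    (fun ab : R * R => fst ab <= snd ab /\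
       forall s, Rmin (fst ab) (snd ab) <= s <= Rmax (fst ab) (snd ab) -> P s).
Proof.
  intros HP.
  apply (Filter_prod _ _ _ (fun a => 0 < a < 1 / 2) (fun b => 1 / 2 < b < 1)).
  - exists (mkposreal (1 / 2) ltac:(lra)). intros y Hy Hy0.
    change (Rabs (y - 0) < 1 / 2) in Hy. apply Rabs_def2 in Hy. lra.
  - exists (mkposreal (1 / 2) ltac:(lra)). intros y Hy Hy0.
    change (Rabs (y - 1) < 1 / 2) in Hy. apply Rabs_def2 in Hy. lra.
  - intros a b Ha Hb. simpl. split; [lra|]. intros s. rewrite Rmin_left; [|lra].
    rewrite Rmax_right; [|lra]. intros Hs. apply HP. lra.
Qed.

Lemma is_Cint01_ext (f g : R -> C) (l : C) :
  (forall s, 0 < s < 1 -> f s = g s) -> is_Cint01 f l -> is_Cint01 g l.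
Proof.
  intros E. apply is_RInt_gen_ext.
  generalize (at_right_left_01 _ E). apply filter_imp. intros ab [_ H] s Hs. apply H. lra.
Qed.

Lemma is_Cint01_unique (f : R -> C) (l : C) :
  is_Cint01 f l ->
  @RInt_gen C_R_CompleteNormedModule f (at_right 0) (at_left 1) = l.
Proof. intros H. exact (@is_RInt_gen_unique C_R_CompleteNormedModule _ _ _ _ f l H). Qed.

(** Convergence is encoded by a primitive with finite limits at both ends. Changes of variable then
    become compositions, and comparison of integrals becomes comparison of increments. *)
Definition improper01 (g : R -> R) (I : R) : Prop :=
  exists (G : R -> R) (a b : R), I = b - a /\
    (forall s, 0 < s < 1 -> is_derive G s (g s)) /\
    (forall s, 0 < s < 1 -> continuous g s) /\
    filterlim G (at_right 0) (locally a) /\ filterlim G (at_left 1) (locally b).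

Lemma improper01_is_RInt_gen (g : R -> R) (I : R) :
  improper01 g I -> is_RInt_gen g (at_right 0) (at_left 1) I.
Proof.
  intros [G [a [b [-> [HG [Hg [Ha Hb]]]]]]].
  assert (Hloc : forall s, 0 < s < 1 -> locally s (fun y => 0 < y < 1)).
  { intros s Hs. apply (open_and _ _ (open_gt 0) (open_lt 1)). exact Hs. }
  apply is_RInt_gen_ext with (Derive G).
  { generalize (at_right_left_01 _ (fun s Hs => is_derive_unique _ _ _ (HG s Hs))).
    apply filter_imp. intros ab [_ H] s Hs. apply H. lra. }
  apply is_RInt_gen_Derive; try assumption.
  - generalize (at_right_left_01 _ (fun s Hs => ex_intro _ _ (HG s Hs) : ex_derive G s)).
    apply filter_imp. now intros ab [_ H].
  - assert (HD : forall s, 0 < s < 1 -> continuous (Derive G) s).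
    { intros s Hs. apply (continuous_ext_loc _ g); [|now apply Hg].
      generalize (Hloc s Hs). apply filter_imp. intros y Hy. symmetry.
      now apply is_derive_unique, HG. }
    generalize (at_right_left_01 _ HD). apply filter_imp. now intros ab [_ H].
Qed.

Lemma improper01_ext (g h : R -> R) (I : R) :
  (forall s, 0 < s < 1 -> g s = h s) -> improper01 g I -> improper01 h I.
Proof.
  intros E [G [a [b [HI [HG [Hg [Ha Hb]]]]]]].
  exists G, a, b. split; [exact HI|]. split; [|split; [|now split]].
  - intros s Hs. rewrite -E //. now apply HG.
  - intros s Hs. apply (continuous_ext_loc _ g); [|now apply Hg].
    assert (Hl : locally s (fun y => 0 < y < 1))
      by (apply (open_and _ _ (open_gt 0) (open_lt 1)); exact Hs).
    revert Hl. apply filter_imp. exact E.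
Qed.

Lemma improper01_plus (g h : R -> R) (I J : R) :
  improper01 g I -> improper01 h J -> improper01 (fun s => g s + h s) (I + J).
Proof.
  intros [G [a [b [-> [HG [Hg [Ha Hb]]]]]]] [G' [a' [b' [-> [HG' [Hg' [Ha' Hb']]]]]]].
  exists (fun s => G s + G' s), (a + a'), (b + b'). split; [ring|]. split; [|split; [|split]].
  - intros s Hs. apply: is_derive_plus; auto.
  - intros s Hs. apply: continuous_plus; auto.
  - exact (filterlim_comp_2 _ _ Rplus Ha Ha' (filterlim_plus (V := R_NormedModule) a a')).
  - exact (filterlim_comp_2 _ _ Rplus Hb Hb' (filterlim_plus (V := R_NormedModule) b b')).
Qed.

Lemma improper01_scal (c : R) (g : R -> R) (I : R) :
  improper01 g I -> improper01 (fun s => c * g s) (c * I).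
Proof.
  intros [G [a [b [-> [HG [Hg [Ha Hb]]]]]]].
  exists (fun s => c * G s), (c * a), (c * b). split; [ring|]. split; [|split; [|split]].
  - intros s Hs. apply: is_derive_scal; auto.
  - intros s Hs. apply: continuous_mult; [apply continuous_const|auto].
  - exact (filterlim_comp _ _ _ _ _ _ _ _ Ha (filterlim_scal_r (V := R_NormedModule) c a)).
  - exact (filterlim_comp _ _ _ _ _ _ _ _ Hb (filterlim_scal_r (V := R_NormedModule) c b)).
Qed.

(** The primitive becomes [- G (1 - s)] and the two limits are exchanged; this transports the
    estimates at the endpoint 0 to the endpoint 1. *)
Lemma improper01_reflect (g : R -> R) (I : R) :
  improper01 g I -> improper01 (fun s => g (1 - s)) I.
Proof.
  intros [G [a [b [-> [HG [Hg [Ha Hb]]]]]]].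
  assert (Hc : forall s, continuous (fun s => 1 - s) s).
  { intros s. apply: continuous_minus; [apply continuous_const | apply continuous_id]. }
  exists (fun s => - G (1 - s)), (- b), (- a). split; [ring|]. split; [|split; [|split]].
  - intros s Hs. 
    assert (HD : is_derive (fun s => G (1 - s)) s (- g (1 - s))).
    { replace (- g (1 - s)) with (scal (-1) (g (1 - s)))
        by (change (-1 * g (1 - s) = - g (1 - s)); ring).
      apply (is_derive_comp G (fun s => 1 - s)); [apply HG; lra|].
      auto_derive; [exact Logic.I|ring]. }
    replace (g (1 - s)) with (opp (- g (1 - s))) by apply: opp_opp.
    now apply: is_derive_opp.
  - intros s Hs. apply (continuous_comp (fun s => 1 - s)); [apply Hc|]. apply Hg. lra.
  - refine (filterlim_comp _ _ _ _ _ _ _ _ _ (filterlim_opp b)).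
    refine (filterlim_comp _ _ _ (fun s => 1 - s) G _ _ _ _ Hb).
    intros P [e He]. exists e. intros y Hy Hy0. apply He; [|lra].
    change (Rabs (y - 0) < e) in Hy. change (Rabs (1 - y - 1) < e).
    replace (1 - y - 1) with (- (y - 0)) by ring. now rewrite Rabs_Ropp.
  - refine (filterlim_comp _ _ _ _ _ _ _ _ _ (filterlim_opp a)).
    refine (filterlim_comp _ _ _ (fun s => 1 - s) G _ _ _ _ Ha).
    intros P [e He]. exists e. intros y Hy Hy0. apply He; [|lra].
    change (Rabs (y - 1) < e) in Hy. change (Rabs (1 - y - 0) < e).
    replace (1 - y - 0) with (- (y - 1)) by ring. now rewrite Rabs_Ropp.
Qed.

(** Both [G - F] and [G + F] have a nonnegative derivative, so the mean value theorem bounds the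
    increment of [F] from both sides. *)
Lemma increment_le (F G f g : R -> R) (u v : R) : 0 < u < 1 -> 0 < v < 1 ->
  (forall s, 0 < s < 1 -> is_derive F s (f s)) ->
  (forall s, 0 < s < 1 -> is_derive G s (g s)) ->
  (forall s, 0 < s < 1 -> Rabs (f s) <= g s) ->
  Rabs (F v - F u) <= Rabs (G v - G u).
Proof.
  assert (Hle : forall u v, 0 < u < 1 -> 0 < v < 1 -> u <= v ->
    (forall s, 0 < s < 1 -> is_derive F s (f s)) ->
    (forall s, 0 < s < 1 -> is_derive G s (g s)) ->
    (forall s, 0 < s < 1 -> Rabs (f s) <= g s) ->
    Rabs (F v - F u) <= Rabs (G v - G u)).
  { clear u v. intros u v Hu Hv Huv HF HG Hfg.
    destruct (MVT_gen (fun s => G s - F s) u v (fun s => g s - f s)) as [c [Hc E]].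
    { intros s Hs. rewrite Rmin_left // Rmax_right // in Hs.
      apply: is_derive_minus; [apply HG | apply HF]; lra. }
    { intros s Hs. rewrite Rmin_left // Rmax_right // in Hs.
      apply continuity_pt_filterlim.
      apply (ex_derive_continuous (V := R_NormedModule) (fun s => G s - F s) s).
      exists (minus (g s) (f s)). apply: is_derive_minus; [apply HG | apply HF]; lra. }
    destruct (MVT_gen (fun s => G s + F s) u v (fun s => g s + f s)) as [c' [Hc' E']].
    { intros s Hs. rewrite Rmin_left // Rmax_right // in Hs.
      apply: is_derive_plus; [apply HG | apply HF]; lra. }
    { intros s Hs. rewrite Rmin_left // Rmax_right // in Hs.
      apply continuity_pt_filterlim.
      apply (ex_derive_continuous (V := R_NormedModule) (fun s => G s + F s) s).
      exists (plus (g s) (f s)). apply: is_derive_plus; [apply HG | apply HF]; lra. }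
    rewrite Rmin_left // Rmax_right // in Hc. rewrite Rmin_left // Rmax_right // in Hc'.
    assert (H1 := Hfg c ltac:(lra)). assert (H2 := Hfg c' ltac:(lra)).
    apply Rabs_le_between in H1. apply Rabs_le_between in H2.
    eapply Rle_trans; [|apply Rle_abs]. apply Rabs_le_between. simpl in E, E'. nra. }
  intros Hu Hv HF HG Hfg. destruct (Rle_dec u v) as [H|H]; [now apply Hle|].
  rewrite Rabs_minus_sym (Rabs_minus_sym (G v)). apply Hle; try assumption. lra.
Qed.

(** The primitive of [f] based at 1/2 has increments bounded by those of [G]. As [G] converges at
    each endpoint, this primitive satisfies the Cauchy criterion there, and completeness gives its
    limits. *)
Lemma ex_RInt_gen_dominated (f g : R -> R) (I : R) : improper01 g I ->
  (forall s, 0 < s < 1 -> continuous f s) ->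
  (forall s, 0 < s < 1 -> Rabs (f s) <= g s) ->
  exists l, is_RInt_gen f (at_right 0) (at_left 1) l.
Proof.
  intros [G [a [b [-> [HG [Hg [Ha Hb]]]]]]] Hf Hfg.
  set (F := fun x => RInt f (1 / 2) x).
  assert (HF : forall s, 0 < s < 1 -> is_derive F s (f s)).
  { intros s Hs. apply (is_derive_RInt f F (1 / 2)); [|now apply Hf].
    assert (Hl : locally s (fun y => 0 < y < 1))
      by (apply (open_and _ _ (open_gt 0) (open_lt 1)); exact Hs).
    revert Hl. apply filter_imp. intros y Hy. apply: RInt_correct.
    apply: ex_RInt_continuous. intros z Hz. apply Hf. revert Hz.
    unfold Rmin, Rmax. destruct (Rle_dec (1 / 2) y); lra. }
  assert (Hlim : forall (Fl : (R -> Prop) -> Prop) (c : R), ProperFilter Fl ->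
    Fl (fun s => 0 < s < 1) -> filterlim G Fl (locally c) ->
    exists d, filterlim F Fl (locally d)).
  { intros Fl c HFl H01 Hc. apply (filterlim_locally_cauchy (U := R_CompleteSpace)).
    intros eps. exists (fun s => (0 < s < 1) /\ Rabs (G s - c) < eps / 2). split.
    - apply filter_and; [exact H01|].
      apply (Hc (fun y => Rabs (y - c) < eps / 2)).
      exists (mkposreal (eps / 2) ltac:(apply is_pos_div_2)). intros y Hy. exact Hy.
    - intros u v [Hu Hu'] [Hv Hv']. change (Rabs (F v - F u) < eps).
      eapply Rle_lt_trans; [now apply (increment_le F G f g)|].
      replace (G v - G u) with ((G v - c) - (G u - c)) by ring.
      eapply Rle_lt_trans; [apply Rabs_triang|]. rewrite Rabs_Ropp. lra. }
  destruct (Hlim (at_right 0) a _) as [la Hla].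
  { exists (mkposreal 1 Rlt_0_1). intros y Hy Hy0.
    change (Rabs (y - 0) < 1) in Hy. apply Rabs_def2 in Hy. lra. }
  { exact Ha. }
  destruct (Hlim (at_left 1) b _) as [lb Hlb].
  { exists (mkposreal 1 Rlt_0_1). intros y Hy Hy0.
    change (Rabs (y - 1) < 1) in Hy. apply Rabs_def2 in Hy. lra. }
  { exact Hb. }
  exists (lb - la). apply improper01_is_RInt_gen.
  exists F, la, lb. now repeat (split; [first [reflexivity|assumption]|]).
Qed.

Lemma is_Cint01_dominated (f : R -> C) (g : R -> R) (I : R) : improper01 g I ->
  (forall s, 0 < s < 1 -> Ccontinuous f s) ->
  (forall s, 0 < s < 1 -> Cmod (f s) <= g s) ->
  exists l, is_Cint01 f l.
Proof.
  intros Hg Hf Hfg.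
  destruct (ex_RInt_gen_dominated (fun s => fst (f s)) g I Hg) as [l1 H1].
  { intros s Hs. now apply Hf. }
  { intros s Hs. eapply Rle_trans; [apply re_le_Cmod | now apply Hfg]. }
  destruct (ex_RInt_gen_dominated (fun s => snd (f s)) g I Hg) as [l2 H2].
  { intros s Hs. now apply Hf. }
  { intros s Hs. eapply Rle_trans; [apply im_le_Cmod | now apply Hfg]. }
  exists (l1, l2). now apply is_Cint01_components.
Qed.

Lemma is_Cint01_norm_le (f : R -> C) (g : R -> R) (l : C) (I : R) : improper01 g I ->
  is_Cint01 f l -> (forall s, 0 < s < 1 -> Cmod (f s) <= g s) -> Cmod l <= I.
Proof.
  intros Hg Hf Hfg.
  assert (HN : forall z : C, @norm R_AbsRing C_R_NormedModule z = Cmod z).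
  { intros [x y]. change (sqrt (Rabs x ^ 2 + Rabs y ^ 2) = sqrt (x ^ 2 + y ^ 2)).
    now rewrite !pow2_abs. }
  rewrite -HN.
  apply (RInt_gen_norm (V := C_R_CompleteNormedModule) (Fa := at_right 0) (Fb := at_left 1) f g).
  - generalize (at_right_left_01 _ Hfg). apply filter_imp. now intros ab [H _].
  - generalize (at_right_left_01 _ Hfg). apply filter_imp. intros ab [H H'] s Hs.
    rewrite HN. apply H'. rewrite Rmin_left // Rmax_right //.
  - exact Hf.
  - now apply improper01_is_RInt_gen.
Qed.

(** * Integrating power series with respect to the parameter *)

Lemma is_Cseries_tail_le (u : nat -> C) (v : nat -> R) (l : C) (N : nat) :
  is_Cseries u l -> (forall n, Cmod (u n) <= v n) -> ex_series v ->
  Cmod (l - @sum_n C_AbelianMonoid u N)%C <= Series v - sum_n v N.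
Proof.
  intros Hu Huv Hv.
  apply (is_Cseries_norm_le (fun k => u (S N + k)%nat) (fun k => v (S N + k)%nat)).
  - apply is_Cseries_is_series. apply (is_series_incr_n u (S N)); [lia|].
    change (pred (S N)) with N.
    replace (plus _ _) with l; [now apply is_Cseries_is_series|].
    change (l = (l - @sum_n C_AbelianMonoid u N + @sum_n C_AbelianMonoid u N)%C). ring.
  - intros n. apply Huv.
  - apply (is_series_incr_n v (S N)); [lia|]. change (pred (S N)) with N.
    replace (plus _ _) with (Series v); [now apply Series_correct|].
    change (Series v = (Series v - sum_n v N) + sum_n v N). ring.
Qed.

Lemma is_Cseries_of_tail (u : nat -> C) (l : C) (e : nat -> R) :
  (forall N, Cmod (l - @sum_n C_AbelianMonoid u N)%C <= e N) -> is_lim_seq e 0 -> is_Cseries u l.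
Proof.
  intros He Hl. split; (eapply is_series_of_tail; [|exact Hl]); intros N; rewrite Rabs_minus_sym.
  - rewrite -fst_sum_n. eapply Rle_trans; [|apply He].
    apply (re_le_Cmod (l - @sum_n C_AbelianMonoid u N)%C).
  - rewrite -snd_sum_n. eapply Rle_trans; [|apply He].
    apply (im_le_Cmod (l - @sum_n C_AbelianMonoid u N)%C).
Qed.

(** The coefficients are the integrals of [W s * c s n]. For fixed [z], the remainder of the
    expansion of [f s] is at most a geometric tail that does not depend on [s]; integrating it
    against the majorant [g] costs only the factor [I]. *)
Lemma unif_analytic_integral (f : R -> C -> C) (W g : R -> R) (I : R) (w0 : C) :
  unif_analytic f w0 -> improper01 g I ->
  (forall s, 0 < s < 1 -> continuous W s) -> (forall s, 0 < s < 1 -> 0 <= W s <= g s) ->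
  exists (r : R) (a : nat -> C), 0 < r /\
    forall z, Cmod z < r ->
      exists l, is_Cint01 (fun s => RtoC (W s) * f s (w0 + z)%C)%C l /\
                is_Cseries (fun n => a n * z ^ n)%C l.
Proof.
  intros [rho [M [c [Hr Hc]]]] Hg HWc HW.
  assert (Hterm : forall n, exists l, is_Cint01 (fun s => RtoC (W s) * c s n)%C l).
  { intros n. assert (Hp : 0 < rho ^ n) by now apply pow_lt.
    apply is_Cint01_dominated with (fun s => M / rho ^ n * g s) (M / rho ^ n * I).
    - now apply improper01_scal.
    - intros s Hs. apply Ccontinuous_mult; [now apply Ccontinuous_RtoC, HWc | now apply Hc].
    - intros s Hs. destruct (HW s Hs) as [W1 W2]. destruct (Hc s Hs) as [C1 _].
      rewrite Cmod_mult Cmod_R Rabs_pos_eq //. rewrite Rmult_comm.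
      apply Rmult_le_compat; try assumption; [apply Cmod_ge_0|].
      apply Rle_div_r; [assumption|apply C1]. }
  apply functional_choice in Hterm. destruct Hterm as [a Ha].
  exists rho, a. split; [exact Hr|]. intros z Hz.
  pose proof (Cmod_ge_0 z) as Hz0.
  set (v := fun n => M * (Cmod z / rho) ^ n).
  assert (Hv : ex_series v) by (apply ex_series_geom_scal; lra).
  assert (Hcz : forall s, 0 < s < 1 -> forall n, Cmod (c s n * z ^ n)%C <= v n).
  { intros s Hs n. apply Cmod_pow_le_geom; [exact Hr|]. now apply Hc. }
  assert (Hf : forall s, 0 < s < 1 -> Ccontinuous (fun s => f s (w0 + z)%C) s).
  { intros s Hs.
    set (d := Rmin s (1 - s)). assert (Hd : 0 < d) by (apply Rmin_pos; lra).
    assert (Hin : forall y, Rabs (y - s) < d -> 0 < y < 1).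
    { intros y Hy. assert (d <= s) by apply Rmin_l. assert (d <= 1 - s) by apply Rmin_r.
      apply Rabs_def2 in Hy. lra. }
    apply (Ccontinuous_ext_loc (fun s => Csum (fun n => c s n * z ^ n)%C)).
    { exists (mkposreal d Hd). intros y Hy. apply Csum_unique. now apply Hc, Hz; apply Hin. }
    apply Ccontinuous_Csum with v (mkposreal d Hd); [|exact Hv|].
    - intros n y Hy. now apply Hcz, Hin.
    - intros n y Hy. apply Ccontinuous_mult; [|apply Ccontinuous_const]. now apply Hc, Hin. }
  assert (Hfv : forall s, 0 < s < 1 -> Cmod (f s (w0 + z)%C) <= Series v).
  { intros s Hs. apply (is_Cseries_norm_le _ v _ _ (proj2 (proj2 (Hc s Hs)) z Hz)); [now apply Hcz|].
    now apply Series_correct. }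
  destruct (is_Cint01_dominated (fun s => RtoC (W s) * f s (w0 + z)%C)%C
              (fun s => Series v * g s) (Series v * I)) as [l Hl].
  { now apply improper01_scal. }
  { intros s Hs. apply Ccontinuous_mult; [now apply Ccontinuous_RtoC, HWc | now apply Hf]. }
  { intros s Hs. destruct (HW s Hs) as [W1 W2].
    rewrite Cmod_mult Cmod_R Rabs_pos_eq // Rmult_comm.
    apply Rmult_le_compat; try assumption; [apply Cmod_ge_0 | now apply Hfv]. }
  exists l. split; [exact Hl|].
  assert (Hpart : forall N, is_Cint01
    (fun s => RtoC (W s) * @sum_n C_AbelianMonoid (fun n => c s n * z ^ n)%C N)%C
    (@sum_n C_AbelianMonoid (fun n => a n * z ^ n)%C N)).
  { induction N as [|N IH].
    - rewrite csum_O. apply is_Cint01_ext with (fun s => z ^ 0 * (RtoC (W s) * c s 0%nat))%C.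
      { intros s _. rewrite csum_O. ring. }
      rewrite Cmult_comm. now apply is_Cint01_scal.
    - rewrite csum_S.
      apply is_Cint01_ext with (fun s => RtoC (W s) * @sum_n C_AbelianMonoid (fun n => c s n * z ^ n) N
         + z ^ S N * (RtoC (W s) * c s (S N)))%C.
      { intros s _. rewrite csum_S. ring. }
      apply is_Cint01_plus; [exact IH|].
      rewrite (Cmult_comm (a (S N))). now apply is_Cint01_scal. }
  apply is_Cseries_of_tail with (fun N => I * (Series v - sum_n v N)).
  - intros N.
    apply (is_Cint01_norm_le (fun s => RtoC (W s) * f s (w0 + z) + - RtoC 1 *
       (RtoC (W s) * @sum_n C_AbelianMonoid (fun n => c s n * z ^ n) N))%C
       (fun s => (Series v - sum_n v N) * g s)).
    + rewrite Rmult_comm. now apply improper01_scal.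
    + replace (l - _)%C
        with (l + - RtoC 1 * @sum_n C_AbelianMonoid (fun n => a n * z ^ n)%C N)%C
        by cring.
      apply is_Cint01_plus; [exact Hl|]. apply is_Cint01_scal, Hpart.
    + intros s Hs. destruct (HW s Hs) as [W1 W2].
      replace (_ + _)%C
        with (RtoC (W s) * (f s (w0 + z) - @sum_n C_AbelianMonoid (fun n => c s n * z ^ n) N))%C
        by cring.
      rewrite Cmod_mult Cmod_R Rabs_pos_eq // Rmult_comm.
      apply Rmult_le_compat; try assumption; [apply Cmod_ge_0|].
      apply is_Cseries_tail_le; [now apply Hc | now apply Hcz | exact Hv].
  - replace (Finite 0) with (Rbar_mult I 0) by (simpl; f_equal; ring).
    apply is_lim_seq_scal_l, is_lim_seq_Series_tail, Hv.
Qed.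

(** This accounts for the factor [w = w0 + z] in front of the convolution integral: multiplication
    by [z] shifts the coefficients by one. *)
Lemma is_Cseries_mul_affine (a : nat -> C) (w0 z l : C) :
  is_Cseries (fun n => a n * z ^ n)%C l ->
  is_Cseries (fun n => (w0 * a n + match n with O => RtoC 0 | S m => a m end) * z ^ n)%C
    ((w0 + z) * l)%C.
Proof.
  intros Hl.
  assert (Hs : is_Cseries
    (fun n => match n with O => RtoC 0 | S m => z * (a m * z ^ m) end)%C (z * l)%C).
  { destruct (is_Cseries_scal z _ _ Hl) as [H1 H2]. split.
    - apply is_series_decr_1. simpl.
      change (is_series (fun k => fst (z * (a k * z ^ k))%C)
        (fst (z * l)%C + - 0)).
      now rewrite Ropp_0 Rplus_0_r.
    - apply is_series_decr_1. simpl.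
      change (is_series (fun k => snd (z * (a k * z ^ k))%C)
        (snd (z * l)%C + - 0)).
      now rewrite Ropp_0 Rplus_0_r. }
  replace ((w0 + z) * l)%C with (w0 * l + z * l)%C by ring.
  refine (is_Cseries_ext _ _ _ _ (is_Cseries_plus _ _ _ _ (is_Cseries_scal w0 _ _ Hl) Hs)).
  intros [|n]; simpl; ring.
Qed.

(** * The scalar estimate *)

Lemma is_derive_Rpower (p s : R) : 0 < s ->
  is_derive (fun s => Rpower s p) s (p * Rpower s (p - 1)).
Proof. intros Hs. apply is_derive_Reals. now apply derivable_pt_lim_power. Qed.

Lemma continuous_Rpower (p s : R) : 0 < s -> continuous (fun s => Rpower s p) s.
Proof.
  intros Hs. apply (ex_derive_continuous (V := R_NormedModule)).
  eexists. now apply is_derive_Rpower.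
Qed.

Lemma filterlim_Rpower_0 (p : R) : 0 < p ->
  filterlim (fun s => Rpower s p) (at_right 0) (locally 0).
Proof.
  intros Hp P [e He].
  (* The value of [Rpower] at 0 is a mere default, so the limit is taken by hand: [s ^ p < e] as
     soon as [s < e ^ (1 / p)]. *)
  assert (Hd : 0 < Rpower e (/ p)) by apply exp_pos.
  exists (mkposreal _ Hd). intros s Hs Hs0. apply He.
  change (Rabs (s - 0) < Rpower e (/ p)) in Hs. change (Rabs (Rpower s p - 0) < e).
  rewrite Rminus_0_r Rabs_pos_eq in Hs; [|lra].
  rewrite Rminus_0_r Rabs_pos_eq; [|left; apply exp_pos].
  replace (pos e) with (Rpower (Rpower e (/ p)) p).
  - apply Rlt_Rpower_l; lra.
  - rewrite Rpower_mult Rinv_l; [|lra]. apply Rpower_1, cond_pos.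
Qed.

Lemma filterlim_Rpower_1 (p : R) :
  filterlim (fun s => Rpower s p) (at_left 1) (locally 1).
Proof.
  assert (H := continuous_Rpower p 1 Rlt_0_1). unfold continuous in H.
  assert (E : Rpower 1 p = 1) by (unfold Rpower; now rewrite ln_1 Rmult_0_r exp_0).
  rewrite E in H.
  exact (filterlim_filter_le_1 _ (filter_le_within _) H).
Qed.

Lemma improper01_Rpower (p : R) : 0 < p -> improper01 (fun s => Rpower s (p - 1)) (/ p).
Proof.
  intros Hp. replace (/ p) with (/ p * 1) by ring.
  apply (improper01_ext (fun s => / p * (p * Rpower s (p - 1)))).
  { intros s _. field. lra. }
  apply improper01_scal. exists (fun s => Rpower s p), 0, 1.
  split; [ring|]. split; [|split; [|split]].
  - intros s Hs. now apply is_derive_Rpower.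
  - intros s Hs. apply: continuous_mult; [apply continuous_const | now apply continuous_Rpower].
  - now apply filterlim_Rpower_0.
  - apply filterlim_Rpower_1.
Qed.

Definition int_inv_1_pow (k : nat) (U : R) : R := RInt (fun u => / (1 + u ^ (2 * k))) 0 U.

Lemma pow_even_nonneg (u : R) (k : nat) : 0 <= u ^ (2 * k).
Proof. rewrite pow_mult. apply pow_le, pow2_ge_0. Qed.

Lemma is_derive_int_inv_1_pow (k : nat) (U : R) : is_derive (int_inv_1_pow k) U (/ (1 + U ^ (2 * k))).
Proof.
  assert (Hc : forall u, continuous (fun u => / (1 + u ^ (2 * k))) u).
  { intros u. apply (ex_derive_continuous (V := R_NormedModule)).
    assert (H : 1 + u ^ (2 * k) <> 0) by (pose proof (pow_even_nonneg u k); lra).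
    auto_derive. exact H. }
  apply (is_derive_RInt (fun u => / (1 + u ^ (2 * k))) (int_inv_1_pow k) 0); [|apply Hc].
  apply filter_forall. intros y. apply: RInt_correct. apply: ex_RInt_continuous.
  intros z _. apply Hc.
Qed.

Lemma is_derive_nondecreasing (D d : R -> R) (u v : R) : u <= v ->
  (forall s, u <= s <= v -> is_derive D s (d s)) -> (forall s, u <= s <= v -> 0 <= d s) ->
  D u <= D v.
Proof.
  intros Huv HD Hd. destruct (MVT_gen D u v d) as [c [Hc E]].
  - intros s Hs. rewrite Rmin_left // Rmax_right // in Hs. apply HD. lra.
  - intros s Hs. rewrite Rmin_left // Rmax_right // in Hs. apply continuity_pt_filterlim.
    apply (ex_derive_continuous (V := R_NormedModule) D s). eexists. now apply HD.
  - rewrite Rmin_left // Rmax_right // in Hc. specialize (Hd c Hc). nra.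
Qed.

Lemma is_derive_inv_pow (n : nat) (s : R) : (0 < n)%nat -> 0 < s ->
  is_derive (fun u => - / (INR n * u ^ n)) s (/ s ^ S n).
Proof.
  intros Hn Hs. assert (HN : 0 < INR n) by now apply lt_0_INR.
  assert (0 < s ^ n) by now apply pow_lt.
  auto_derive; [apply Rgt_not_eq; now apply Rmult_lt_0_compat|].
  assert (Hp : 0 < s ^ pred n) by now apply pow_lt.
  assert (E : s ^ n = s * s ^ pred n) by (destruct n; [lia|reflexivity]).
  simpl pow. rewrite E. field. lra.
Qed.

Lemma int_inv_1_pow_0 (k : nat) : int_inv_1_pow k 0 = 0.
Proof. apply: RInt_point. Qed.

(** The integrand is at most 1 on [0,1], which contributes at most 1, and at most [u ^ (- 2 k)]
    beyond, which contributes at most [1 / (2 k - 1)]. The bound does not depend on [U]. *)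
Lemma int_inv_1_pow_bounds (k : nat) (U : R) : (1 <= k)%nat -> 0 <= U ->
  0 <= int_inv_1_pow k U <= 2 * INR k / (2 * INR k - 1).
Proof.
  intros Hk HU.
  assert (HK : 1 <= INR k) by (apply (le_INR 1); exact Hk).
  assert (Hpos : forall u, 0 < / (1 + u ^ (2 * k))).
  { intros u. apply Rinv_0_lt_compat. pose proof (pow_even_nonneg u k). lra. }
  split.
  - rewrite -(int_inv_1_pow_0 k). apply (is_derive_nondecreasing (int_inv_1_pow k)
      (fun u => / (1 + u ^ (2 * k)))).
    + exact HU.
    + intros s _. apply is_derive_int_inv_1_pow.
    + intros s _. left. apply Hpos.
  - assert (Hle : forall V, 0 <= V -> int_inv_1_pow k V <= V).
    { intros V HV.
      enough (0 - int_inv_1_pow k 0 <= V - int_inv_1_pow k V) by (rewrite int_inv_1_pow_0 in H; lra).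
      apply (is_derive_nondecreasing (fun u => u - int_inv_1_pow k u)
        (fun u => 1 - / (1 + u ^ (2 * k)))).
      - exact HV.
      - intros s _. apply: is_derive_minus; [apply: is_derive_id | apply is_derive_int_inv_1_pow].
      - intros s _. pose proof (pow_even_nonneg s k).
        enough (/ (1 + s ^ (2 * k)) <= 1) by lra.
        rewrite -{2}Rinv_1. apply Rinv_le_contravar; lra. }
    replace (2 * INR k / (2 * INR k - 1)) with (1 + / (2 * INR k - 1)) by (field; lra).
    assert (Hn : 0 < / (2 * INR k - 1)) by (apply Rinv_0_lt_compat; lra).
    destruct (Rle_dec U 1) as [HU1|HU1]; [specialize (Hle U HU); lra|].
    assert (H1 := Hle 1 Rle_0_1).
    destruct k as [|k]; [lia|].
    (* After the case split [k] denotes the predecessor of the original index, so [n] is twice that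
       index minus 1, the exponent left after integrating the power. *)
    set (n := S (2 * k)).
    assert (En : (2 * S k = S n)%nat) by (unfold n; lia).
    assert (EN : 2 * INR (S k) - 1 = INR n).
    { apply (f_equal INR) in En. rewrite mult_INR (S_INR n) in En.
      change (INR 2) with (1 + 1) in En. lra. }
    rewrite EN in Hn |- *.
    assert (HN : 0 < INR n) by (apply lt_0_INR; unfold n; lia).
    assert (Hm : - (/ (INR n * 1 ^ n)) - int_inv_1_pow (S k) 1
      <= - (/ (INR n * U ^ n)) - int_inv_1_pow (S k) U).
    { apply (is_derive_nondecreasing (fun u => - (/ (INR n * u ^ n)) - int_inv_1_pow (S k) u)
              (fun u => / u ^ S n - / (1 + u ^ (2 * S k)))).
      - lra.
      - intros s Hs. assert (0 < s ^ n) by (apply pow_lt; lra).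
        apply: is_derive_minus; [|apply is_derive_int_inv_1_pow].
        apply is_derive_inv_pow; [unfold n; lia|lra].
      - intros s Hs. rewrite En. assert (0 < s ^ S n) by (apply pow_lt; lra).
        enough (/ (1 + s ^ S n) <= / s ^ S n) by lra. apply Rinv_le_contravar; lra. }
    rewrite pow1 Rmult_1_r in Hm.
    assert (0 < / (INR n * U ^ n)).
    { apply Rinv_0_lt_compat, Rmult_lt_0_compat; [exact HN | apply pow_lt; lra]. }
    lra.
Qed.

Lemma pow_Rpower_inv (s : R) (k : nat) : (1 <= k)%nat -> 0 < s -> Rpower s (/ INR k) ^ k = s.
Proof.
  intros Hk Hs. assert (1 <= INR k) by (apply (le_INR 1); exact Hk).
  rewrite -Rpower_pow; [|apply exp_pos]. rewrite Rpower_mult Rinv_l; [|lra]. now apply Rpower_1.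
Qed.

Lemma pow_2k (a : R) (k : nat) : a ^ (2 * k) = (a ^ k) ^ 2.
Proof. rewrite Nat.mul_comm. apply pow_mult. Qed.

Definition kernel_majorant (k : nat) (y s : R) : R :=
  y * Rpower s (/ INR k - 1) / (1 + (y ^ k * s) ^ 2).

(** With [u = y * Rpower s (/ INR k)] one has [u ^ (2 k) = (y ^ k * s) ^ 2], and the factor
    [/ INR k] from the derivative of [u] is compensated by the factor [INR k] of the primitive. *)
Lemma improper01_kernel_majorant (k : nat) (y : R) : (1 <= k)%nat -> 0 <= y ->
  improper01 (kernel_majorant k y) (INR k * int_inv_1_pow k y).
Proof.
  intros Hk Hy. assert (HK : 1 <= INR k) by (apply (le_INR 1); exact Hk).
  set (p := / INR k). assert (Hp : 0 < p) by (apply Rinv_0_lt_compat; lra).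
  exists (fun s => INR k * int_inv_1_pow k (y * Rpower s p)), 0, (INR k * int_inv_1_pow k y).
  assert (HAc : forall U, continuous (fun U => INR k * int_inv_1_pow k U) U).
  { intros U. apply: continuous_mult; [apply continuous_const|].
    apply (ex_derive_continuous (V := R_NormedModule) (int_inv_1_pow k)).
    eexists. apply is_derive_int_inv_1_pow. }
  split; [ring|]. split; [|split; [|split]].
  - intros s Hs.
    assert (E : kernel_majorant k y s
      = INR k * ((y * (p * Rpower s (p - 1))) * / (1 + (y * Rpower s p) ^ (2 * k)))).
    { assert (EP : Rpower s p ^ k = s) by (apply pow_Rpower_inv; [exact Hk|lra]).
      unfold kernel_majorant. fold p. rewrite pow_2k (Rpow_mult_distr y) EP.
      replace (INR k * (y * (p * Rpower s (p - 1)) * / (1 + (y ^ k * s) ^ 2)))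
        with ((INR k * p) * (y * Rpower s (p - 1) * / (1 + (y ^ k * s) ^ 2))) by ring.
      unfold p at 2. rewrite Rinv_r; [|lra]. unfold Rdiv. ring. }
    rewrite E. apply: is_derive_scal.
    apply (is_derive_comp (int_inv_1_pow k) (fun s => y * Rpower s p)); [apply is_derive_int_inv_1_pow|].
    apply: is_derive_scal. apply is_derive_Rpower. lra.
  - intros s Hs. unfold kernel_majorant. fold p.
    apply: continuous_mult.
    + apply: continuous_mult; [apply continuous_const | apply continuous_Rpower; lra].
    + apply (ex_derive_continuous (V := R_NormedModule)). auto_derive.
      pose proof (pow2_ge_0 (y ^ k * s)). simpl in H. lra.
  - assert (E : INR k * int_inv_1_pow k (y * 0) = 0) by (rewrite Rmult_0_r int_inv_1_pow_0; ring).
    rewrite -{2}E.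
    refine (filterlim_comp _ _ _ (fun s => y * Rpower s p)
              (fun U => INR k * int_inv_1_pow k U) _ _ _ _ (HAc _)).
    exact (filterlim_comp _ _ _ _ _ _ _ _ (filterlim_Rpower_0 p Hp)
             (filterlim_scal_r (V := R_NormedModule) y 0)).
  - rewrite -{2}(Rmult_1_r y).
    refine (filterlim_comp _ _ _ (fun s => y * Rpower s p)
              (fun U => INR k * int_inv_1_pow k U) _ _ _ _ (HAc _)).
    exact (filterlim_comp _ _ _ _ _ _ _ _ (filterlim_Rpower_1 p)
             (filterlim_scal_r (V := R_NormedModule) y 1)).
Qed.

(** The left side is the bound on the integral of the kernel majorant. Since the cosine is [sin z]
    with [z = PI / (2 k)], a lower bound for [q k] needs an upper bound for a sine. *)
Lemma q_lower (k : nat) : (1 <= k)%nat ->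
  0 < q k /\ 4 * INR k * (2 * INR k / (2 * INR k - 1) + 1) <= q k.
Proof.
  intros Hk. assert (HK : 1 <= INR k) by (apply (le_INR 1); exact Hk).
  pose proof PI_RGT_0 as Hpi.
  enough (H : 4 * INR k * (2 * INR k / (2 * INR k - 1) + 1) <= q k).
  { split; [|exact H]. eapply Rlt_le_trans; [|exact H].
    apply Rmult_lt_0_compat; [lra|].
    assert (0 < 2 * INR k / (2 * INR k - 1)) by (apply Rdiv_lt_0_compat; lra). lra. }
  unfold q. set (z := PI / (2 * INR k)).
  assert (Ez : PI * (INR k - 1) / (2 * INR k) = PI / 2 - z) by (unfold z; field; lra).
  rewrite Ez cos_shift.
  assert (Hz : 0 < z <= PI / 2).
  { unfold z. split; [apply Rdiv_lt_0_compat; lra|].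
    unfold Rdiv. apply Rmult_le_compat_l; [lra|]. apply Rinv_le_contravar; lra. }
  assert (Hs : 0 < sin z) by (apply sin_gt_0; lra).
  assert (Hs1 : sin z <= z) by (left; apply sin_lt_x; lra).
  destruct (Nat.eq_dec k 1) as [->|Hk1].
  (* Here [sin z <= z] would lose too much: it yields 8, whereas 12 is required. The exact value is
     [q 1 = 4 PI], and [PI > 3]. *)
  - assert (E : z = PI / 2) by (unfold z; simpl; field). rewrite E sin_PI2. simpl INR.
    replace ((4 * 1 - 1) / 1) with (INR 3) by (simpl; field).
    rewrite Rpower_pow; [|lra]. pose proof PI2_3_2. simpl. lra.
  - assert (HK2 : 2 <= INR k) by (apply (le_INR 2); lia).
    assert (H1 : INR k <= PI / (2 * sin z)).
    { apply Rle_trans with (PI / (2 * z)); [right; unfold z; field; lra|].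
      unfold Rdiv. apply Rmult_le_compat_l; [lra|]. apply Rinv_le_contravar; lra. }
    (* For [k >= 2] the bracket in the goal is at most [4 / 3 + 1], so the left side is at most
       [28 / 3] times [k]. The power of 2 is at least [8 sqrt 2], and [sqrt 2 >= 7 / 6] suffices. *)
    assert (H2 : 28 / 3 <= Rpower 2 ((4 * INR k - 1) / INR k)).
    { apply Rle_trans with (Rpower 2 (INR 3 + / 2)).
      - rewrite Rpower_plus Rpower_pow; [|lra]. rewrite Rpower_sqrt; [|lra].
        assert (7 / 6 <= sqrt 2); [|simpl; lra].
        apply Rsqr_incr_0_var; [|apply sqrt_pos]. rewrite Rsqr_sqrt; [|lra]. unfold Rsqr. lra.
      - apply Rle_Rpower; [lra|]. simpl.
        replace ((4 * INR k - 1) / INR k) with (4 - / INR k) by (field; lra).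
        assert (/ INR k <= / 2) by (apply Rinv_le_contravar; lra). lra. }
    assert (H3 : 2 * INR k / (2 * INR k - 1) <= 4 / 3) by (apply Rle_div_l; lra).
    replace (Rpower 2 ((4 * INR k - 1) / INR k) * PI / (2 * sin z))
      with (Rpower 2 ((4 * INR k - 1) / INR k) * (PI / (2 * sin z))) by (field; lra).
    apply Rle_trans with (28 / 3 * INR k); [nra|]. apply Rmult_le_compat; lra.
Qed.

(** * The weight of the convolution and its kernel *)

Definition convweight (k : nat) (s : R) : R := Rpower (s * (1 - s)) ((1 - INR k) / INR k).

Lemma Rpower_minus_1 (s p : R) : 0 < s -> Rpower s p = s * Rpower s (p - 1).
Proof.
  intros Hs. rewrite -{2}(Rpower_1 s Hs) -Rpower_plus. f_equal. ring.
Qed.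

Lemma Rpower_le_1 (s p : R) : 0 < s < 1 -> 0 <= p -> Rpower s p <= 1.
Proof.
  intros Hs Hp. assert (E : Rpower 1 p = 1) by (unfold Rpower; now rewrite ln_1 Rmult_0_r exp_0).
  rewrite -E. apply Rle_Rpower_l; lra.
Qed.

(* Multiplying by [1 = s + (1 - s)] separates the two endpoint singularities. *)
Lemma convweight_split (k : nat) (s : R) : (1 <= k)%nat -> 0 < s < 1 ->
  convweight k s = Rpower s (/ INR k) * Rpower (1 - s) (/ INR k - 1)
                   + Rpower s (/ INR k - 1) * Rpower (1 - s) (/ INR k).
Proof.
  intros Hk Hs. assert (HK : 1 <= INR k) by (apply (le_INR 1); exact Hk).
  unfold convweight. replace ((1 - INR k) / INR k) with (/ INR k - 1) by (field; lra).
  rewrite -Rpower_mult_distr; [|lra|lra].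
  rewrite (Rpower_minus_1 s (/ INR k)); [|lra].
  rewrite (Rpower_minus_1 (1 - s) (/ INR k)); [|lra]. ring.
Qed.

Lemma convweight_le (k : nat) (s : R) : (1 <= k)%nat -> 0 < s < 1 ->
  0 <= convweight k s <= Rpower s (/ INR k - 1) + Rpower (1 - s) (/ INR k - 1).
Proof.
  intros Hk Hs. split; [left; apply exp_pos|].
  assert (HK : 1 <= INR k) by (apply (le_INR 1); exact Hk).
  assert (Hp : 0 <= / INR k) by (left; apply Rinv_0_lt_compat; lra).
  rewrite convweight_split //.
  pose proof (Rpower_le_1 s (/ INR k) Hs Hp).
  pose proof (Rpower_le_1 (1 - s) (/ INR k) ltac:(lra) Hp).
  pose proof (exp_pos ((/ INR k - 1) * ln s)). pose proof (exp_pos ((/ INR k - 1) * ln (1 - s))).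
  unfold Rpower in *. nra.
Qed.

Lemma continuous_convweight (k : nat) (s : R) : 0 < s < 1 -> continuous (convweight k) s.
Proof.
  intros Hs. apply (continuous_comp (fun s => s * (1 - s)) (fun u => Rpower u ((1 - INR k) / INR k))).
  - apply: continuous_mult; [apply continuous_id|].
    apply: continuous_minus; [apply continuous_const | apply continuous_id].
  - apply continuous_Rpower. nra.
Qed.

Lemma improper01_convweight (k : nat) : (1 <= k)%nat ->
  improper01 (fun s => Rpower s (/ INR k - 1) + Rpower (1 - s) (/ INR k - 1)) (INR k + INR k).
Proof.
  intros Hk. assert (HK : 1 <= INR k) by (apply (le_INR 1); exact Hk).
  assert (H := improper01_Rpower (/ INR k) ltac:(apply Rinv_0_lt_compat; lra)).
  rewrite Rinv_inv in H. apply improper01_plus; [exact H|].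
  apply (improper01_reflect (fun s => Rpower s (/ INR k - 1))). exact H.
Qed.

(** Beyond 1, [t] is at most [t ^ k], hence at most its square. Applied to [t = y s ^ (1 / k)], this
    lets the denominator absorb the factor [y]. *)
Lemma le_1_pow_2k (t : R) (k : nat) : (1 <= k)%nat -> 0 <= t -> t <= 1 + (t ^ k) ^ 2.
Proof.
  intros Hk Ht. pose proof (pow2_ge_0 (t ^ k)).
  destruct (Rle_dec t 1); [lra|].
  assert (t <= t ^ k).
  { rewrite -{1}(pow_1 t). apply Rle_pow; [lra|exact Hk]. }
  simpl in *. nra.
Qed.

(* With [a = x (1-s)] and [b = x s], [a + b = x] gives
   [1 + x^2 <= 2 (1 + a^2) + 2 (1 + b^2)]. *)
Lemma kernel_le (k : nat) (y s : R) : (1 <= k)%nat -> 0 <= y -> 0 < s < 1 ->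
  y * convweight k s * ((1 + (y ^ k) ^ 2)
    / ((1 + (y ^ k * (1 - s)) ^ 2) * (1 + (y ^ k * s) ^ 2)))
  <= 2 * ((kernel_majorant k y s + kernel_majorant k y (1 - s))
          + (Rpower s (/ INR k - 1) + Rpower (1 - s) (/ INR k - 1))).
Proof.
  (* The two parts of [convweight_split] are treated differently. In the part singular at 1,
     [y * Rpower s (/ INR k)] is absorbed by the denominator; in the part singular at 0, the factor
     [Rpower (1 - s) (/ INR k)] is at most 1 and [kernel_majorant] remains. *)
  assert (Hhalf : forall s, (1 <= k)%nat -> 0 <= y -> 0 < s < 1 ->
    y * convweight k s / (1 + (y ^ k * s) ^ 2)
    <= kernel_majorant k y s + Rpower (1 - s) (/ INR k - 1)).
  { clear s. intros s Hk Hy Hs. assert (HK : 1 <= INR k) by (apply (le_INR 1); exact Hk).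
    assert (Hp : 0 <= / INR k) by (left; apply Rinv_0_lt_compat; lra).
    rewrite convweight_split //. unfold kernel_majorant.
    assert (Hb : y * Rpower s (/ INR k) <= 1 + (y ^ k * s) ^ 2).
    { assert (EP : (y * Rpower s (/ INR k)) ^ k = y ^ k * s).
      { rewrite Rpow_mult_distr pow_Rpower_inv //. lra. }
      rewrite -EP. apply le_1_pow_2k; [exact Hk|].
      apply Rmult_le_pos; [exact Hy | left; apply exp_pos]. }
    pose proof (Rpower_le_1 (1 - s) (/ INR k) ltac:(lra) Hp).
    pose proof (exp_pos ((/ INR k - 1) * ln s)) as Hu.
    pose proof (exp_pos ((/ INR k - 1) * ln (1 - s))) as Hv.
    change (0 < Rpower s (/ INR k - 1)) in Hu. change (0 < Rpower (1 - s) (/ INR k - 1)) in Hv.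
    assert (HB : 0 < 1 + (y ^ k * s) ^ 2) by (pose proof (pow2_ge_0 (y ^ k * s)); lra).
    apply Rle_div_l; [exact HB|]. rewrite Rmult_plus_distr_r.
    unfold Rdiv at 1. rewrite (Rmult_assoc _ (/ _)) Rinv_l; [|lra].
    assert (Hyu : 0 <= y * Rpower s (/ INR k - 1)) by (apply Rmult_le_pos; lra). nra. }
  intros Hk Hy Hs.
  assert (H1 := Hhalf s Hk Hy Hs). assert (H2 := Hhalf (1 - s) Hk Hy ltac:(lra)).
  replace (1 - (1 - s)) with s in H2 by ring.
  assert (EW : convweight k (1 - s) = convweight k s).
  { unfold convweight. f_equal. ring. }
  rewrite EW in H2.
  set (A := 1 + (y ^ k * (1 - s)) ^ 2) in *. set (B := 1 + (y ^ k * s) ^ 2) in *.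
  assert (HA : 0 < A) by (unfold A; pose proof (pow2_ge_0 (y ^ k * (1 - s))); lra).
  assert (HB : 0 < B) by (unfold B; pose proof (pow2_ge_0 (y ^ k * s)); lra).
  assert (HW : 0 <= y * convweight k s).
  { apply Rmult_le_pos; [exact Hy|]. now apply convweight_le. }
  apply Rle_trans with (y * convweight k s * (2 / A + 2 / B)).
  - apply Rmult_le_compat_l; [exact HW|].
    replace (2 / A + 2 / B) with ((2 * A + 2 * B) / (A * B)) by (field; lra).
    apply Rmult_le_compat_r; [left; apply Rinv_0_lt_compat; nra|].
    unfold A, B. pose proof (pow2_ge_0 (y ^ k * (1 - s) - y ^ k * s)). nra.
  - replace (y * convweight k s * (2 / A + 2 / B))
      with (2 * (y * convweight k s / A + y * convweight k s / B)) by (field; lra). lra.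
Qed.

Lemma improper01_kernel (k : nat) (y : R) : (1 <= k)%nat -> 0 <= y ->
  exists I, I <= q k /\
    improper01 (fun s => 2 * ((kernel_majorant k y s + kernel_majorant k y (1 - s))
          + (Rpower s (/ INR k - 1) + Rpower (1 - s) (/ INR k - 1)))) I.
Proof.
  intros Hk Hy. assert (HK : 1 <= INR k) by (apply (le_INR 1); exact Hk).
  exists (2 * ((INR k * int_inv_1_pow k y + INR k * int_inv_1_pow k y) + (INR k + INR k))). split.
  - destruct (q_lower k Hk) as [_ Hq]. eapply Rle_trans; [|exact Hq].
    destruct (int_inv_1_pow_bounds k y Hk Hy) as [_ HA].
    replace (2 * (INR k * int_inv_1_pow k y + INR k * int_inv_1_pow k y + (INR k + INR k)))
      with (4 * INR k * (int_inv_1_pow k y + 1)) by ring.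
    apply Rmult_le_compat_l; lra.
  - apply improper01_scal. apply improper01_plus; [|now apply improper01_convweight].
    apply improper01_plus; [now apply improper01_kernel_majorant|].
    apply (improper01_reflect (kernel_majorant k y)). now apply improper01_kernel_majorant.
Qed.

(** * Pointwise bounds for the convolution *)

Definition ray_point (k : nat) (w : C) (s : R) : C := (w * RtoC (Rpower s (/ INR k)))%C.

Lemma Gweight_ray_point (mu : R) (k : nat) (w : C) (s : R) : (1 <= k)%nat -> 0 < s ->
  Gweight mu k (ray_point k w s)
  = (1 + ((mu * Cmod w) ^ k * s) ^ 2) * exp (- ((mu * Cmod w) ^ k * s)).
Proof.
  intros Hk Hs. unfold Gweight, ray_point.
  rewrite -!Rpow_mult_distr pow_2k.
  assert (E : (mu * Cmod (w * RtoC (Rpower s (/ INR k)))%C) ^ k = (mu * Cmod w) ^ k * s).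
  { rewrite Cmod_mult Cmod_R Rabs_pos_eq; [|left; apply exp_pos].
    rewrite -Rmult_assoc (Rpow_mult_distr (mu * Cmod w)) pow_Rpower_inv //. }
  now rewrite E.
Qed.

Lemma Gweight_eq (mu : R) (k : nat) (w : C) :
  Gweight mu k w = (1 + ((mu * Cmod w) ^ k) ^ 2) * exp (- (mu * Cmod w) ^ k).
Proof. unfold Gweight. now rewrite -!Rpow_mult_distr pow_2k. Qed.

Lemma Gweight_pos (mu : R) (k : nat) (w : C) : 0 < Gweight mu k w.
Proof.
  rewrite Gweight_eq. apply Rmult_lt_0_compat; [|apply exp_pos].
  pose proof (pow2_ge_0 ((mu * Cmod w) ^ k)). lra.
Qed.

Lemma conv_integrand_le (mu A B : R) (k : nat) (H J : C -> C) (w : C) (s : R) :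
  (1 <= k)%nat -> 0 < s < 1 ->
  (forall s, 0 < s < 1 -> Cmod (H (ray_point k w s)) * Gweight mu k (ray_point k w s) <= A) ->
  (forall s, 0 < s < 1 -> Cmod (J (ray_point k w s)) * Gweight mu k (ray_point k w s) <= B) ->
  Cmod (conv_integrand k H J w s) <=
    A * B * exp ((mu * Cmod w) ^ k) * (convweight k s *
      / ((1 + ((mu * Cmod w) ^ k * (1 - s)) ^ 2) * (1 + ((mu * Cmod w) ^ k * s) ^ 2))).
Proof.
  intros Hk Hs HH HJ. assert (Hs' : 0 < 1 - s < 1) by lra.
  specialize (HH _ Hs'). specialize (HJ _ Hs).
  rewrite Gweight_ray_point // in HJ; [|lra]. rewrite Gweight_ray_point // in HH; [|lra].
  set (x := (mu * Cmod w) ^ k) in *.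
  unfold conv_integrand. fold (convweight k s). fold (ray_point k w s). fold (ray_point k w (1 - s)).
  rewrite !Cmod_mult Cmod_R Rabs_pos_eq; [|left; apply exp_pos].
  assert (HW : 0 <= convweight k s) by now apply convweight_le.
  set (a := 1 + (x * (1 - s)) ^ 2) in *. set (b := 1 + (x * s) ^ 2) in *.
  assert (Ha : 0 < a) by (unfold a; pose proof (pow2_ge_0 (x * (1 - s))); lra).
  assert (Hb : 0 < b) by (unfold b; pose proof (pow2_ge_0 (x * s)); lra).
  pose proof (Cmod_ge_0 (H (ray_point k w (1 - s)))) as H0.
  pose proof (Cmod_ge_0 (J (ray_point k w s))) as J0.
  pose proof (exp_pos (- (x * (1 - s)))) as E1. pose proof (exp_pos (- (x * s))) as E2.
  assert (Eprod : exp x * (exp (- (x * (1 - s))) * exp (- (x * s))) = 1).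
  { rewrite -!exp_plus.
    replace (x + (- (x * (1 - s)) + - (x * s))) with 0 by ring. apply exp_0. }
  set (e1 := exp (- (x * (1 - s)))) in *. set (e2 := exp (- (x * s))) in *.
  set (h := Cmod (H (ray_point k w (1 - s)))) in *. set (j := Cmod (J (ray_point k w s))) in *.
  assert (HP : (h * (a * e1)) * (j * (b * e2)) <= A * B).
  { apply Rmult_le_compat; try assumption; apply Rmult_le_pos; try assumption;
      apply Rmult_le_pos; lra. }
  pose proof (exp_pos x) as Ex.
  apply Rle_trans with
    ((h * (a * e1)) * (j * (b * e2)) * exp x * (convweight k s * / (a * b))).
  - right.
    replace (h * (a * e1) * (j * (b * e2)) * exp x * (convweight k s * / (a * b)))
      with (convweight k s * h * j * (exp x * (e1 * e2))) by (field; lra).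
    rewrite Eprod. ring.
  - apply Rmult_le_compat_r.
    + apply Rmult_le_pos; [exact HW|]. left. apply Rinv_0_lt_compat. now apply Rmult_lt_0_compat.
    + apply Rmult_le_compat_r; [lra|exact HP].
Qed.

Lemma Ccontinuous_conv_integrand (k : nat) (H J : C -> C) (w : C) (s : R) : (1 <= k)%nat ->
  (forall t, 0 < t < 1 -> Ccontinuous (fun t => H (w * RtoC t)%C) t) ->
  (forall t, 0 < t < 1 -> Ccontinuous (fun t => J (w * RtoC t)%C) t) ->
  0 < s < 1 -> Ccontinuous (conv_integrand k H J w) s.
Proof.
  intros Hk HH HJ Hs. assert (HK : 1 <= INR k) by (apply (le_INR 1); exact Hk).
  assert (Hp : 0 < / INR k) by (apply Rinv_0_lt_compat; lra).
  assert (Hin : forall s, 0 < s < 1 -> 0 < Rpower s (/ INR k) < 1).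
  { intros u Hu. split; [apply exp_pos|].
    assert (E : Rpower 1 (/ INR k) = 1) by (unfold Rpower; now rewrite ln_1 Rmult_0_r exp_0).
    rewrite -E. apply Rlt_Rpower_l; lra. }
  unfold conv_integrand. apply Ccontinuous_mult; [apply Ccontinuous_mult|].
  - apply Ccontinuous_RtoC. now apply (continuous_convweight k).
  - apply (Ccontinuous_comp (fun t => H (w * RtoC t)%C) (fun s => Rpower (1 - s) (/ INR k))).
    + apply (continuous_comp (fun s => 1 - s) (fun u => Rpower u (/ INR k))).
      * apply: continuous_minus; [apply continuous_const | apply continuous_id].
      * apply continuous_Rpower. lra.
    + apply HH, Hin. lra.
  - apply (Ccontinuous_comp (fun t => J (w * RtoC t)%C) (fun s => Rpower s (/ INR k))).
    + apply continuous_Rpower. lra.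
    + now apply HJ, Hin.
Qed.

Lemma conv_bound (mu A B : R) (k : nat) (H J : C -> C) (w : C) :
  0 < mu -> (1 <= k)%nat -> 0 <= A -> 0 <= B ->
  (forall t, 0 < t < 1 -> Ccontinuous (fun t => H (w * RtoC t)%C) t) ->
  (forall t, 0 < t < 1 -> Ccontinuous (fun t => J (w * RtoC t)%C) t) ->
  (forall s, 0 < s < 1 -> Cmod (H (ray_point k w s)) * Gweight mu k (ray_point k w s) <= A) ->
  (forall s, 0 < s < 1 -> Cmod (J (ray_point k w s)) * Gweight mu k (ray_point k w s) <= B) ->
  exists l, is_Cint01 (conv_integrand k H J w) l /\
    Cmod (w * l)%C * Gweight mu k w <= q k / mu * A * B.
Proof.
  intros Hmu Hk HA HB HHc HJc HH HJ.
  pose proof (Cmod_ge_0 w) as Hw.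
  set (y := mu * Cmod w). assert (Hy : 0 <= y) by (apply Rmult_le_pos; lra).
  set (x := y ^ k).
  assert (Hle := fun s Hs => conv_integrand_le mu A B k H J w s Hk Hs HH HJ).
  fold y in Hle. fold x in Hle.
  assert (HAB : 0 <= A * B) by now apply Rmult_le_pos.
  pose proof (exp_pos x) as Ex.
  assert (Hab : forall s, 1 <= (1 + (x * (1 - s)) ^ 2) * (1 + (x * s) ^ 2)).
  { intros s. pose proof (pow2_ge_0 (x * (1 - s))). pose proof (pow2_ge_0 (x * s)). nra. }
  (* Convergence is settled with a majorant free of the factor [y]: the sharper kernel bounds only
     [y] times the integrand and says nothing about it at [w = 0]. *)
  destruct (is_Cint01_dominated (conv_integrand k H J w)
    (fun s => A * B * exp x * (Rpower s (/ INR k - 1) + Rpower (1 - s) (/ INR k - 1)))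
    (A * B * exp x * (INR k + INR k))) as [l Hl].
  { apply improper01_scal. now apply improper01_convweight. }
  { intros s Hs. now apply Ccontinuous_conv_integrand. }
  { intros s Hs. eapply Rle_trans; [now apply Hle|].
    apply Rmult_le_compat_l; [apply Rmult_le_pos; lra|].
    destruct (convweight_le k s Hk Hs) as [W1 W2].
    assert (/ ((1 + (x * (1 - s)) ^ 2) * (1 + (x * s) ^ 2)) <= 1).
    { eapply Rle_trans; [apply Rinv_le_contravar; [apply Rlt_0_1|apply Hab]|].
      rewrite Rinv_1. apply Rle_refl. }
    nra. }
  exists l. split; [exact Hl|].
  destruct (improper01_kernel k y Hk Hy) as [I [HI Hker]].
  (* This is [mu * Cmod w * Gweight mu k w]. Bringing it inside the integral before estimating
     produces exactly the left side of [kernel_le], and it is the source of the [1 / mu] in the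
     final bound. *)
  set (c := y * (1 + x ^ 2) * exp (- x)).
  pose proof (pow2_ge_0 x) as Hx2. pose proof (exp_pos (- x)) as Ex'.
  assert (Hc : 0 <= c) by (unfold c; apply Rmult_le_pos; [apply Rmult_le_pos|]; lra).
  assert (HN : Cmod (RtoC c * l)%C <= A * B * I).
  { apply (is_Cint01_norm_le _ _ _ _ (improper01_scal (A * B) _ _ Hker)
             (is_Cint01_scal (RtoC c) _ _ Hl)).
    intros s Hs. rewrite Cmod_mult Cmod_R Rabs_pos_eq //.
    eapply Rle_trans; [apply Rmult_le_compat_l; [exact Hc | now apply Hle]|].
    eapply Rle_trans; [|apply Rmult_le_compat_l; [exact HAB | now apply kernel_le]].
    right. fold x. unfold c.
    replace (y * (1 + x ^ 2) * exp (- x) * (A * B * exp x * (convweight k s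
      * / ((1 + (x * (1 - s)) ^ 2) * (1 + (x * s) ^ 2)))))
      with ((exp (- x) * exp x) * (A * B * (y * convweight k s *
        ((1 + x ^ 2) / ((1 + (x * (1 - s)) ^ 2) * (1 + (x * s) ^ 2))))))
      by (unfold Rdiv; ring).
    rewrite -exp_plus Rplus_opp_l exp_0. ring. }
  rewrite Gweight_eq. fold y. fold x.
  rewrite Cmod_mult Cmod_R Rabs_pos_eq // in HN. rewrite Cmod_mult.
  replace (Cmod w * Cmod l * ((1 + x ^ 2) * exp (- x))) with (/ mu * (c * Cmod l))
    by (unfold c, y; field; lra).
  replace (q k / mu * A * B) with (/ mu * (A * B * q k)) by (unfold Rdiv; ring).
  apply Rmult_le_compat_l; [left; now apply Rinv_0_lt_compat|].
  eapply Rle_trans; [exact HN|]. now apply Rmult_le_compat_l.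
Qed.

(** * The space of the theorem *)

Lemma Omega_star (nu theta alpha : R) (w : C) (t : R) : 0 < nu ->
  Omega nu theta alpha w -> 0 <= t <= 1 -> Omega nu theta alpha (w * RtoC t)%C.
Proof.
  intros Hnu [Hw|Hw] Ht.
  - left. unfold Defs.disc in *. rewrite Cmod_mult Cmod_R Rabs_pos_eq; [|lra].
    pose proof (Cmod_ge_0 w). nra.
  (* The sector omits 0, so the end of the segment has to be placed in the disc. *)
  - destruct (Req_dec t 0) as [->|Ht0].
    + left. unfold Defs.disc. now rewrite Cmult_0_r Cmod_0.
    + right. destruct Hw as [r [phi [Hr [Hphi ->]]]]. exists (r * t), phi.
      split; [apply Rmult_lt_0_compat; lra|]. split; [exact Hphi|].
      unfold Cmult, RtoC. simpl. f_equal; ring.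
Qed.

Lemma Omega_0 (nu theta alpha : R) : 0 < nu -> Omega nu theta alpha (RtoC 0).
Proof. intros Hnu. left. unfold Defs.disc. now rewrite Cmod_0. Qed.

Lemma Gnorm_le (nu theta alpha mu : R) (k : nat) (H : C -> C) (B : R) (w : C) :
  Rbar_le (Gnorm nu theta alpha mu k H) B -> Omega nu theta alpha w ->
  Cmod (H w) * Gweight mu k w <= B.
Proof.
  intros HB Hw. apply (Rbar_le_trans (Finite _) _ (Finite _)) with (2 := HB).
  apply (proj1 (Lub_Rbar_correct _)). now exists w.
Qed.

(** The point 0 belongs to [Omega], so the supremum is over a nonempty set and cannot be minus
    infinity. *)
Lemma Gnorm_lub (nu theta alpha mu : R) (k : nat) (H : C -> C) (B : R) : 0 < nu ->
  (forall w, Omega nu theta alpha w -> Cmod (H w) * Gweight mu k w <= B) ->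
  is_finite (Gnorm nu theta alpha mu k H) /\ Rbar_le (Gnorm nu theta alpha mu k H) B.
Proof.
  intros Hnu HB.
  assert (H1 : Rbar_le (Gnorm nu theta alpha mu k H) B).
  { apply (proj2 (Lub_Rbar_correct _)). intros x [w [Hw ->]]. now apply HB. }
  assert (H0 : Rbar_le (Cmod (H (RtoC 0)) * Gweight mu k (RtoC 0)) (Gnorm nu theta alpha mu k H)).
  { apply (proj1 (Lub_Rbar_correct _)). exists (RtoC 0). split; [now apply Omega_0|reflexivity]. }
  split; [|exact H1]. destruct (Gnorm nu theta alpha mu k H); simpl in *; try easy.
Qed.

Lemma Gnorm_bound_nonneg (nu theta alpha mu : R) (k : nat) (H : C -> C) (B : R) : 0 < nu ->
  Rbar_le (Gnorm nu theta alpha mu k H) B -> 0 <= B.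
Proof.
  intros Hnu HB.
  eapply Rle_trans; [|exact (Gnorm_le _ _ _ _ _ _ _ _ HB (Omega_0 nu theta alpha Hnu))].
  apply Rmult_le_pos; [apply Cmod_ge_0 | left; apply Gweight_pos].
Qed.

Lemma Gspace_ray_continuous (nu theta alpha mu : R) (k : nat) (H : C -> C) (w : C) (t : R) :
  0 < nu -> Gspace nu theta alpha mu k H -> Omega nu theta alpha w -> 0 < t < 1 ->
  Ccontinuous (fun t => H (w * RtoC t)%C) t.
Proof.
  intros Hnu [HA _] Hw Ht.
  apply (unif_analytic_continuous (fun t w => H (w * RtoC t)%C) w); [|exact Ht].
  apply (ray_unif_analytic (Omega nu theta alpha)); [|exact HA].
  intros u Hu. now apply Omega_star.
Qed.

Lemma ray_point_Omega (nu theta alpha : R) (k : nat) (w : C) (s : R) : 0 < nu -> (1 <= k)%nat ->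
  Omega nu theta alpha w -> 0 < s < 1 -> Omega nu theta alpha (ray_point k w s).
Proof.
  intros Hnu Hk Hw Hs. assert (HK : 1 <= INR k) by (apply (le_INR 1); exact Hk).
  apply Omega_star; try assumption. split; [left; apply exp_pos|].
  apply Rpower_le_1; [exact Hs|]. left. apply Rinv_0_lt_compat. lra.
Qed.

(** The assumptions are continuity along the ray and bounds on the norms, instead of membership in
    [Gspace]. In this form the estimate applies directly to differences such as [H - H0]. *)
Lemma conv_bound_Omega (nu theta alpha mu A B : R) (k : nat) (H J : C -> C) (w : C) :
  0 < nu -> 0 < mu -> (1 <= k)%nat -> Omega nu theta alpha w ->
  (forall t, 0 < t < 1 -> Ccontinuous (fun t => H (w * RtoC t)%C) t) ->
  (forall t, 0 < t < 1 -> Ccontinuous (fun t => J (w * RtoC t)%C) t) ->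
  Rbar_le (Gnorm nu theta alpha mu k H) A -> Rbar_le (Gnorm nu theta alpha mu k J) B ->
  is_Cint01 (conv_integrand k H J w)
    (@RInt_gen C_R_CompleteNormedModule (conv_integrand k H J w) (at_right 0) (at_left 1)) /\
  Cmod (conv k H J w) * Gweight mu k w <= q k / mu * A * B.
Proof.
  intros Hnu Hmu Hk Hw HHc HJc HA HB.
  destruct (conv_bound mu A B k H J w Hmu Hk) as [l [Hl Hb]]; try assumption.
  - exact (Gnorm_bound_nonneg _ _ _ _ _ _ _ Hnu HA).
  - exact (Gnorm_bound_nonneg _ _ _ _ _ _ _ Hnu HB).
  - intros s Hs. apply (Gnorm_le _ _ _ _ _ _ _ _ HA). now apply ray_point_Omega.
  - intros s Hs. apply (Gnorm_le _ _ _ _ _ _ _ _ HB). now apply ray_point_Omega.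
  - unfold conv. rewrite (is_Cint01_unique _ _ Hl). now split.
Qed.

Lemma Gspace_Gnorm_le (nu theta alpha mu : R) (k : nat) (H : C -> C) :
  Gspace nu theta alpha mu k H ->
  Rbar_le (Gnorm nu theta alpha mu k H) (real (Gnorm nu theta alpha mu k H)).
Proof. intros [_ HF]. rewrite HF. apply Rbar_le_refl. Qed.

(** The singular weight is kept apart from the two analytic factors. These are the ray families of
    [H] and [J], reparametrized by maps of (0,1) into itself, so their product has a uniform
    expansion to integrate against the weight. *)
Lemma conv_analytic (nu theta alpha : R) (k : nat) (H J : C -> C) :
  0 < nu -> (1 <= k)%nat ->
  analytic_on (Omega nu theta alpha) H -> analytic_on (Omega nu theta alpha) J ->
  analytic_on (Omega nu theta alpha) (conv k H J).
Proof.
  intros Hnu Hk HH HJ w0 Hw0. assert (HK : 1 <= INR k) by (apply (le_INR 1); exact Hk).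
  assert (Hp : 0 < / INR k) by (apply Rinv_0_lt_compat; lra).
  assert (Hray : forall t, 0 <= t <= 1 -> Omega nu theta alpha (w0 * RtoC t)%C)
    by (intros t Ht; now apply Omega_star).
  assert (Hin : forall s, 0 < s < 1 -> 0 < Rpower s (/ INR k) < 1).
  { intros u Hu. split; [apply exp_pos|].
    assert (E : Rpower 1 (/ INR k) = 1) by (unfold Rpower; now rewrite ln_1 Rmult_0_r exp_0).
    rewrite -E. apply Rlt_Rpower_l; lra. }
  assert (HU : unif_analytic (fun s w => H (w * RtoC (Rpower (1 - s) (/ INR k)))
                              * J (w * RtoC (Rpower s (/ INR k))))%C w0).
  { apply unif_analytic_mult.
    - apply (unif_analytic_comp (fun t w => H (w * RtoC t)%C) (fun s => Rpower (1 - s) (/ INR k))).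
      + intros s Hs. split; [apply Hin; lra|].
        apply (continuous_comp (fun s => 1 - s) (fun u => Rpower u (/ INR k))).
        * apply: continuous_minus; [apply continuous_const | apply continuous_id].
        * apply continuous_Rpower. lra.
      + now apply (ray_unif_analytic (Omega nu theta alpha)).
    - apply (unif_analytic_comp (fun t w => J (w * RtoC t)%C) (fun s => Rpower s (/ INR k))).
      + intros s Hs. split; [now apply Hin|]. apply continuous_Rpower. lra.
      + now apply (ray_unif_analytic (Omega nu theta alpha)). }
  destruct (unif_analytic_integral _ (convweight k) _ _ w0 HU (improper01_convweight k Hk))
    as [r [a [Hr Ha]]].
  { intros s Hs. now apply continuous_convweight. }
  { intros s Hs. now apply convweight_le. }
  exists r, (fun n => w0 * a n + match n with O => RtoC 0 | S m => a m end)%C.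
  split; [exact Hr|]. intros w Hw. apply pseries_is_Cseries.
  destruct (Ha _ Hw) as [l [Hl1 Hl2]].
  assert (Ew : (w0 + (w - w0))%C = w) by ring. rewrite Ew in Hl1.
  assert (Ec : conv k H J w = ((w0 + (w - w0)) * l)%C).
  { rewrite Ew. unfold conv. f_equal. apply is_Cint01_unique.
    revert Hl1. apply is_Cint01_ext. intros s _. unfold conv_integrand, convweight. ring. }
  rewrite Ec. now apply is_Cseries_mul_affine.
Qed.

Theorem lemma3p3 (nu theta alpha mu : R) (k : nat)
  (hnu : 0 < nu) (halpha : 0 < alpha) (hmu : 0 < mu) (hk : (1 <= k)%nat) :
  let G := Gspace nu theta alpha mu k in
  let N := Gnorm nu theta alpha mu k in
  (* the integral defining the convolution converges on Omega *)
  (forall H J : C -> C, G H -> G J ->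
     forall w : C, Omega nu theta alpha w ->
       @ex_RInt_gen C_R_NormedModule
         (conv_integrand k H J w) (at_right 0) (at_left 1)) /\
  (* the convolution maps G x G to G *)
  (forall H J : C -> C, G H -> G J -> G (conv k H J)) /\
  (* bilinearity *)
  (forall (a b : C) (H1 H2 J : C -> C), G H1 -> G H2 -> G J ->
     forall w : C, Omega nu theta alpha w ->
       conv k (fun z => a * H1 z + b * H2 z)%C J w
       = (a * conv k H1 J w + b * conv k H2 J w)%C) /\
  (forall (a b : C) (H J1 J2 : C -> C), G H -> G J1 -> G J2 ->
     forall w : C, Omega nu theta alpha w ->
       conv k H (fun z => a * J1 z + b * J2 z)%C w
       = (a * conv k H J1 w + b * conv k H J2 w)%C) /\
  (* continuity on G x G *)
  (forall H0 J0 : C -> C, G H0 -> G J0 ->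
     forall eps : R, 0 < eps -> exists delta : R, 0 < delta /\
       forall H J : C -> C, G H -> G J ->
         Rbar_lt (N (fun z => H z - H0 z)%C) delta ->
         Rbar_lt (N (fun z => J z - J0 z)%C) delta ->
         Rbar_lt (N (fun z => conv k H J z - conv k H0 J0 z)%C) eps) /\
  (* the explicit bound *)
  0 < q k /\
  (forall H J : C -> C, G H -> G J ->
     real (N (conv k H J)) <= q k / mu * real (N H) * real (N J)).
Proof.
  intros G N.
  destruct (q_lower k hk) as [Hq _].
  assert (Hray : forall H w, G H -> Omega nu theta alpha w ->
    forall t, 0 < t < 1 -> Ccontinuous (fun t => H (w * RtoC t)%C) t).
  { intros H w HG Hw t Ht. now apply (Gspace_ray_continuous nu theta alpha mu k). }
  assert (Hint : forall H J, G H -> G J -> forall w, Omega nu theta alpha w ->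
    is_Cint01 (conv_integrand k H J w)
      (@RInt_gen C_R_CompleteNormedModule (conv_integrand k H J w) (at_right 0) (at_left 1)) /\
    Cmod (conv k H J w) * Gweight mu k w <= q k / mu * real (N H) * real (N J)).
  { intros H J HG JG w Hw. apply (conv_bound_Omega nu theta alpha); auto;
      now apply Gspace_Gnorm_le. }
  (* [RInt_gen] is additive only on convergent integrals, hence the convergence hypotheses on both
     parts. *)
  assert (Hlin : forall (a b l1 l2 : C) (f1 f2 f : R -> C) (w : C),
    is_Cint01 f1 l1 -> is_Cint01 f2 l2 -> (forall s, f s = a * f1 s + b * f2 s)%C ->
    (w * @RInt_gen C_R_CompleteNormedModule f (at_right 0) (at_left 1)
     = a * (w * l1) + b * (w * l2))%C).
  { intros a b l1 l2 f1 f2 f w H1 H2 E.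
    rewrite (is_Cint01_unique f (a * l1 + b * l2)%C); [ring|].
    refine (is_Cint01_ext _ _ _ (fun s _ => eq_sym (E s)) _).
    apply is_Cint01_plus; now apply is_Cint01_scal. }
  assert (Hfin : forall H J, G H -> G J -> is_finite (N (conv k H J)) /\
    Rbar_le (N (conv k H J)) (q k / mu * real (N H) * real (N J))).
  { intros H J HG JG. apply Gnorm_lub; [exact hnu|]. intros w Hw. now apply Hint. }
  split; [|split; [|split; [|split; [|split; [|split]]]]].
  - intros H J HG JG w Hw. eexists. now apply Hint.
  - intros H J HG JG. split; [|now apply Hfin].
    apply conv_analytic; try assumption; [apply HG | apply JG].
  - intros a b H1 H2 J G1 G2 GJ w Hw. unfold conv.
    apply (Hlin a b _ _ _ _ _ w (proj1 (Hint H1 J G1 GJ w Hw)) (proj1 (Hint H2 J G2 GJ w Hw))).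
    intros s. unfold conv_integrand. ring.
  - intros a b H J1 J2 GH G1 G2 w Hw. unfold conv.
    apply (Hlin a b _ _ _ _ _ w (proj1 (Hint H J1 GH G1 w Hw)) (proj1 (Hint H J2 GH G2 w Hw))).
    intros s. unfold conv_integrand. ring.
  - intros H0 J0 GH0 GJ0 eps Heps.
    set (a := real (N H0)). set (b := real (N J0)).
    assert (Ha : Rbar_le (N H0) a) by now apply Gspace_Gnorm_le.
    assert (Hb : Rbar_le (N J0) b) by now apply Gspace_Gnorm_le.
    assert (Ha0 : 0 <= a) by exact (Gnorm_bound_nonneg _ _ _ _ _ _ _ hnu Ha).
    assert (Hb0 : 0 <= b) by exact (Gnorm_bound_nonneg _ _ _ _ _ _ _ hnu Hb).
    set (Q := q k / mu). assert (HQ : 0 < Q) by now apply Rdiv_lt_0_compat.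
    (* The bound 1 keeps the norm of [J] below [b + 1]. The two pieces of the difference then
       contribute [Q * delta * (b + 1)] and [Q * a * delta], together at most [eps / 2]; the
       remaining half makes the final inequality strict. *)
    set (delta := Rmin 1 (eps / (2 * (Q * (a + b + 1))))).
    assert (HQab : 0 < Q * (a + b + 1)) by (apply Rmult_lt_0_compat; lra).
    assert (Hd : 0 < delta) by (apply Rmin_pos; [lra|apply Rdiv_lt_0_compat; lra]).
    assert (Hd1 : delta <= 1) by apply Rmin_l.
    assert (Hd2 : delta * (2 * (Q * (a + b + 1))) <= eps).
    { apply Rle_div_r; [lra|]. apply Rmin_r. }
    exists delta. split; [exact Hd|]. intros H J GH GJ HH HJ.
    apply Rbar_lt_le in HH. apply Rbar_lt_le in HJ.
    assert (Hsub : forall F F0 : C -> C, G F -> G F0 -> forall w, Omega nu theta alpha w ->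
      forall t, 0 < t < 1 -> Ccontinuous (fun t => F (w * RtoC t) - F0 (w * RtoC t))%C t).
    { intros F F0 GF GF0 w Hw t Ht.
      apply (Ccontinuous_ext_loc (fun t => F (w * RtoC t) + - RtoC 1 * F0 (w * RtoC t))%C).
      { apply filter_forall. intros u. cring. }
      apply Ccontinuous_plus; [now apply Hray|].
      apply Ccontinuous_mult; [apply Ccontinuous_const|now apply Hray]. }
    assert (HJb : Rbar_le (N J) (b + 1)).
    { apply Gnorm_lub; [exact hnu|]. intros w Hw.
      pose proof (Gnorm_le _ _ _ _ _ _ _ _ HJ Hw) as K1. simpl in K1.
      pose proof (Gnorm_le _ _ _ _ _ _ _ _ Hb Hw) as K2.
      pose proof (Cmod_triangle (J w - J0 w) (J0 w)) as K3.
      replace (J w - J0 w + J0 w)%C with (J w) in K3 by ring.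
      pose proof (Gweight_pos mu k w). nra. }
    assert (Hdiff : Rbar_le (N (fun z => conv k H J z - conv k H0 J0 z)%C) (eps / 2)).
    { apply Gnorm_lub; [exact hnu|]. intros w Hw.
      destruct (conv_bound_Omega nu theta alpha mu delta (b + 1) k
        (fun z => H z - H0 z)%C J w) as [I1 B1]; try assumption.
      { intros t Ht. now apply (Hsub H H0). }
      { now apply Hray. }
      destruct (conv_bound_Omega nu theta alpha mu a delta k
        H0 (fun z => J z - J0 z)%C w) as [I2 B2]; try assumption.
      { now apply Hray. }
      { intros t Ht. now apply (Hsub J J0). }
      (* The usual telescoping of a bilinear map through the intermediate term [conv k H0 J w]. *)
      assert (E : (conv k H J w - conv k H0 J0 w
        = conv k (fun z => H z - H0 z) J w + conv k H0 (fun z => J z - J0 z) w)%C).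
      { assert (E1 : conv k H J w = (1 * conv k (fun z => H z - H0 z) J w + 1 * conv k H0 J w)%C).
        { unfold conv at 1. apply (Hlin _ _ _ _ _ _ _ w I1 (proj1 (Hint H0 J GH0 GJ w Hw))).
          intros s. unfold conv_integrand. ring. }
        assert (E2 : conv k H0 J w = (1 * conv k H0 (fun z => J z - J0 z) w + 1 * conv k H0 J0 w)%C).
        { unfold conv at 1. apply (Hlin _ _ _ _ _ _ _ w I2 (proj1 (Hint H0 J0 GH0 GJ0 w Hw))).
          intros s. unfold conv_integrand. ring. }
        rewrite E1 E2. ring. }
      rewrite E. fold Q in B1, B2.
      eapply Rle_trans; [apply Rmult_le_compat_r; [left; apply Gweight_pos|apply Cmod_triangle]|].
      rewrite Rmult_plus_distr_r. nra. }
    apply Rbar_le_lt_trans with (1 := Hdiff). simpl. lra.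
  - exact Hq.
  - intros H J HG JG. destruct (Hfin H J HG JG) as [HF HL]. rewrite -HF in HL. exact HL.
Qed.
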